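(* Let $n\ge1$, $1<r<p<\infty$ and let $X$ be a Banach space such that $$\mathcal{L}_{as(\frac pn;p)}(^nX;l_p)=\mathcal{L}_{as(\frac rn;r)}(^nX;l_p).$$ Then, for every Banach space $Y$, $$\mathcal{L}_{as(\frac pn;p)}(^nX;Y)=\mathcal{L}_{as(\frac1n;1)}(^nX;Y).$$
   Context: All spaces are Banach spaces over $\mathbb{K}=\mathbb{R}$ or $\mathbb{C}$; $l_p$ is the usual scalar sequence space. For $0<p<\infty$, $l_p(E)$ is the space of sequences $(x_j)$ in $E$ with $\sum_j\|x_j\|^p<\infty$, and $l_p^w(E)$ is the space of sequences $(x_j)$ in $E$ with $\sum_j|\varphi(x_j)|^p<\infty$ for every $\varphi\in E'$. For $s,t>0$, $\mathcal{L}_{as(s;t)}(^nE;F)$ denotes the space of continuous $n$-linear mappings $T:E\times\dots\times E\to F$ ($n$ factors) which are absolutely $(s;t,\dots,t)$-summing at the origin, i.e. $(T(x_j^{(1)},\dots,x_j^{(n)}))_j\in l_s(F)$ whenever $(x_j^{(i)})_j\in l_t^w(E)$ for $i=1,\dots,n$. *)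

(* Defs.v *)
From HB Require Import structures.
From mathcomp Require Import all_boot all_order all_algebra.
From mathcomp Require Import complex.
From mathcomp Require Import all_classical all_reals all_analysis.

Set Implicit Arguments.
Unset Strict Implicit.
Unset Printing Implicit Defensive.

Import Order.TTheory GRing.Theory Num.Theory.
Import numFieldNormedType.Exports.

Local Open Scope classical_set_scope.
Local Open Scope ring_scope.

Variant scalar_kind := RealScalars | ComplexScalars.

Definition scalars (R : realType) (k : scalar_kind) : numFieldType :=
  match k with RealScalars => R | ComplexScalars => R[i] end.

(* The norm of a normed space over [scalars R k] takes values in
   [scalars R k]; [realpart] brings it back to [R], and [of_real] is the
   inclusion of [R] into the scalars. *)
Definition realpart (R : realType) (k : scalar_kind) : scalars R k -> R :=
  match k with RealScalars => id | ComplexScalars => @complex.Re R end.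

Definition of_real (R : realType) (k : scalar_kind) : R -> scalars R k :=
  match k with RealScalars => id | ComplexScalars => real_complex R end.
Arguments of_real {R} k _.

Definition rnorm (R : realType) (k : scalar_kind)
  (E : normedModType (scalars R k)) (x : E) : R := realpart `|x|.

(* [power_sum p x] is the sum of ||x_j||^p; [seq_l p E] is l_p(E) and
   [seq_lw p E] is the space of weakly p-summable sequences of E. *)
Definition power_sum (R : realType) (k : scalar_kind) (p : R)
    (E : normedModType (scalars R k)) (x : nat -> E) : \bar R :=
  (\sum_(0 <= j <oo) (rnorm (x j) `^ p)%:E)%E.

Definition seq_l (R : realType) (k : scalar_kind) (p : R)
    (E : normedModType (scalars R k)) : set (nat -> E) :=
  [set x : nat -> E | (power_sum p x < +oo)%E].
Arguments seq_l {R k} p E.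

Definition seq_lw (R : realType) (k : scalar_kind) (p : R)
    (E : normedModType (scalars R k)) : set (nat -> E) :=
  [set x : nat -> E |
     forall phi : {linear E -> (scalars R k)^o}, continuous phi ->
       seq_l p (scalars R k)^o (fun j => phi (x j))].
Arguments seq_lw {R k} p E.

Definition multilinear (K : numFieldType) (n : nat) (E F : lmodType K)
    (T : ('I_n -> E) -> F) : Prop :=
  forall (i : 'I_n) (x : 'I_n -> E),
    linear (fun v : E => T (@dfwith 'I_n (fun=> E) x i v)).

(* Continuous n-linear maps E x ... x E -> F that are absolutely
   (s;t,...,t)-summing at the origin; continuity is for the product topology. *)
Definition L_as (R : realType) (k : scalar_kind) (n : nat) (s t : R)
    (E F : normedModType (scalars R k)) : set (('I_n -> E) -> F) :=
  [set T | [/\ multilinear T,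
     continuous (T : {ptws 'I_n -> E} -> F) &
     forall x : 'I_n -> nat -> E, (forall i, seq_lw t E (x i)) ->
       seq_l s F (fun j => T (fun i => x i j))]].
Arguments L_as {R k} n s t E F.

Section Scalars.
Variables (R : realType) (k : scalar_kind).
Local Notation K := (scalars R k).

Lemma realpart0 : realpart (0 : K) = 0.
Proof. by case: k. Qed.

Lemma realpartD (x y : K) : realpart (x + y) = realpart x + realpart y.
Proof. by case: k x y => //= -[a b] [c d]. Qed.

Lemma of_realK (a : R) : realpart (of_real k a) = a.
Proof. by case: k. Qed.

Lemma of_realD (a b : R) : of_real k (a + b) = of_real k a + of_real k b.
Proof. by case: k => //=; rewrite rmorphD. Qed.

Lemma of_realM (a b : R) : of_real k (a * b) = of_real k a * of_real k b.
Proof. by case: k => //=; rewrite rmorphM. Qed.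

Lemma of_real0 : of_real k (0 : R) = 0.
Proof. by case: k. Qed.

Lemma realpart_ge0K (x : K) : 0 <= x -> of_real k (realpart x) = x.
Proof. by case: k x => //= x x0; rewrite RRe_real// ger0_real. Qed.

Lemma ler_of_real (a b : R) : (of_real k a <= of_real k b) = (a <= b).
Proof. by case: k => //=; exact: lecR. Qed.

Lemma ltr_of_real (a b : R) : (of_real k a < of_real k b) = (a < b).
Proof. by case: k => //=; exact: ltcR. Qed.

Lemma scalars_complete (F : set_system K^o) :
  ProperFilter F -> cauchy F -> cvg F.
Proof.
case: k F => /= F FF; first exact: R_complete.
move=> /cauchy_ballP Fc.
have Re_lt (z : R[i]) e : `|z| < e%:C%C -> `|complex.Re z| < e.
  by move=> ze; rewrite -ltcR (le_lt_trans (normc_ge_Re z)).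
have Im_lt (z : R[i]) e : `|z| < e%:C%C -> `|complex.Im z| < e.
  move=> ze; rewrite -normrN -ReiNIm; apply: Re_lt.
  by rewrite normrM [X in _ * X](_ : _ = 1) ?mulr1// normc_def /= expr0n expr1n add0r sqrtr1.
have ReF : cvg (@complex.Re R @ F : set_system R).
  apply: R_complete; apply/cauchy_ballP => e e0.
  have e0' : (0 : R[i]) < e%:C%C by rewrite ltcR.
  have [[A B] /= [FA FB] AB] := Fc _ e0'.
  exists (@complex.Re R @` A, @complex.Re R @` B) => /=.
    by split; [move: FA|move: FB]; apply: filterS => z Az; exists z.
  move=> [_ _] /= [[x Ax <-] [y By <-]].
  have := AB (x, y) (conj Ax By); rewrite -!ball_normE /= => /Re_lt.
  by rewrite raddfB.
have ImF : cvg (@complex.Im R @ F : set_system R).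
  apply: R_complete; apply/cauchy_ballP => e e0.
  have e0' : (0 : R[i]) < e%:C%C by rewrite ltcR.
  have [[A B] /= [FA FB] AB] := Fc _ e0'.
  exists (@complex.Im R @` A, @complex.Im R @` B) => /=.
    by split; [move: FA|move: FB]; apply: filterS => z Az; exists z.
  move=> [_ _] /= [[x Ax <-] [y By <-]].
  have := AB (x, y) (conj Ax By); rewrite -!ball_normE /= => /Im_lt.
  by rewrite raddfB.
move/cvg_ex : ReF => [a Fa]; move/cvg_ex : ImF => [b Fb].
apply/cvg_ex; exists (a +i* b)%C; apply/cvgrPdist_lt => /= e e0.
have eE : e = (complex.Re e)%:C%C by rewrite RRe_real// gtr0_real.
have e2 : 0 < complex.Re e / 2 by rewrite divr_gt0// -ltcR -eE.
move/cvgrPdist_lt : Fa => /(_ _ e2) Fa.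
move/cvgrPdist_lt : Fb => /(_ _ e2) Fb.
have Fa' : F (fun z => `|a - complex.Re z| < complex.Re e / 2) := Fa.
have Fb' : F (fun z => `|b - complex.Im z| < complex.Re e / 2) := Fb.
apply: filterS2 Fa' Fb' => -[c d] /= ac bd.
have -> : ((a +i* b) - (c +i* d) = (a - c)%:C + (b - d)%:C * 'i)%C.
  by simpc.
rewrite (le_lt_trans (ler_normD _ _))// normrM.
rewrite !normc_def /= !(expr0n, expr1n, add0r, addr0, sqrtr1, mulr1, sqrtr_sqr).
have := ltrD ac bd; rewrite -splitr -ltcR -eE; apply: le_lt_trans.
by rewrite normr1 mulr1 [X in _ <= X]rmorphD.
Qed.

Variable E : normedModType K.
Implicit Types x y : E.

Lemma rnormK x : of_real k (rnorm x) = `|x|.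
Proof. exact: realpart_ge0K. Qed.

Lemma rnorm_ge0 x : 0 <= rnorm x.
Proof. by rewrite -ler_of_real rnormK of_real0. Qed.

Lemma rnorm0 : rnorm (0 : E) = 0.
Proof. by rewrite /rnorm normr0 realpart0. Qed.

Lemma rnorm_eq0 x : rnorm x = 0 -> x = 0.
Proof. by move=> x0; apply/normr0_eq0; rewrite -rnormK x0 of_real0. Qed.

Lemma rnormD x y : rnorm (x + y) <= rnorm x + rnorm y.
Proof. by rewrite -ler_of_real of_realD !rnormK ler_normD. Qed.

Lemma rnormZ (a : K) x : rnorm (a *: x) = realpart `|a| * rnorm x.
Proof.
by rewrite -[RHS]of_realK of_realM rnormK (realpart_ge0K (normr_ge0 _)) -normrZ.
Qed.

End Scalars.

Section SequenceNorm.
Variables (R : realType) (k : scalar_kind) (p : R).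
Hypothesis p1 : 1 <= p.
Local Notation K := (scalars R k).
Variable E : normedModType K.
Implicit Types x y : nat -> E.
Local Open Scope ereal_scope.

Let p0 : (0 < p)%R. Proof. exact: lt_le_trans p1. Qed.
Let p_neq0 : (p != 0)%R. Proof. by rewrite gt_eqF. Qed.

Definition enorm x : \bar R := power_sum p x `^ p^-1.

Lemma power_sum_ge0 x : 0 <= power_sum p x.
Proof. by apply: nneseries_ge0 => j _ _; rewrite lee_fin powR_ge0. Qed.

Lemma enorm_ge0 x : 0 <= enorm x.
Proof. exact: poweR_ge0. Qed.

Lemma enormE x :
  enorm x = Lnorm counting p%:E (EFin \o (fun j => rnorm (x j))).
Proof.
rewrite Lnorm_counting//; congr (_ `^ _); apply: eq_eseriesr => j _ /=.
by rewrite ger0_norm ?rnorm_ge0.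
Qed.

Lemma enorm_lty x : (enorm x < +oo) = (power_sum p x < +oo).
Proof.
apply/idP/idP; last by move=> xoo; rewrite /enorm poweR_lty.
by apply: lty_poweRy; rewrite invr_eq0.
Qed.

Lemma le_enorm x y : (forall j, rnorm (x j) <= rnorm (y j))%R ->
  enorm x <= enorm y.
Proof.
move=> xy; apply: gt0_ler_poweR.
- by rewrite invr_ge0 ltW.
- by rewrite in_itv/= power_sum_ge0 leey.
- by rewrite in_itv/= power_sum_ge0 leey.
- apply: lee_nneseries => j _; first by rewrite lee_fin powR_ge0.
  by rewrite lee_fin ge0_ler_powR ?nnegrE ?rnorm_ge0// ltW.
Qed.

Lemma enormD x y : enorm (x \+ y)%R <= enorm x + enorm y.
Proof.
rewrite !enormE.
have m (f : nat -> R) : measurable_fun [set: nat] f by [].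
apply: le_trans (minkowski_EFin counting (m _) (m _) p1).
rewrite !Lnorm_counting// gt0_ler_poweR//.
- by rewrite invr_ge0 ltW.
- by rewrite in_itv/= leey andbT; apply: nneseries_ge0 => j _ _; rewrite lee_fin powR_ge0.
- by rewrite in_itv/= leey andbT; apply: nneseries_ge0 => j _ _; rewrite lee_fin powR_ge0.
- apply: lee_nneseries => j _ /=; first by rewrite lee_fin powR_ge0.
  rewrite lee_fin ge0_ler_powR ?nnegrE ?normr_ge0 ?(ltW p0)//.
  rewrite !ger0_norm ?addr_ge0 ?rnorm_ge0//; exact: rnormD.
Qed.

Lemma enormZ (a : K) x : enorm (a \*: x)%R = (realpart `|a|)%:E * enorm x.
Proof.
have a0 : (0 <= realpart `|a|)%R by rewrite -(ler_of_real k) of_real0 realpart_ge0K.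
rewrite /enorm (_ : power_sum p (a \*: x)%R = (realpart `|a| `^ p)%:E * power_sum p x).
  rewrite poweRM ?power_sum_ge0 ?lee_fin ?powR_ge0//.
  by rewrite poweR_EFin -powRrM mulfV// powRr1.
rewrite -nneseriesZl; last by move=> j _; rewrite lee_fin powR_ge0.
by apply: eq_eseriesr => j _; rewrite rnormZ powRM ?rnorm_ge0.
Qed.

Lemma enorm0 : enorm (fun=> 0%R) = 0.
Proof.
rewrite /enorm /power_sum eseries0 ?poweR0r ?invr_neq0// => j _ _.
by rewrite rnorm0 powR0.
Qed.

Lemma power_sum_single (c : E) m :
  power_sum p (fun j => if j == m then c else 0%R) = (rnorm c `^ p)%:E.
Proof.
rewrite /power_sum (@nneseriesD1 _ _ m)//= ?eqxx; last by move=> j _; rewrite lee_fin powR_ge0.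
rewrite eseries0 ?adde0// => j _ /= /negbTE ->.
by rewrite rnorm0 powR0.
Qed.

Lemma enorm_single (c : E) m :
  enorm (fun j => if j == m then c else 0%R) = (rnorm c)%:E.
Proof.
by rewrite /enorm power_sum_single poweR_EFin -powRrM mulfV// powRr1 ?rnorm_ge0.
Qed.

Lemma rnorm_le_enorm x m : (rnorm (x m))%:E <= enorm x.
Proof.
rewrite -(enorm_single _ m); apply: le_enorm => j.
by case: eqP => [->|_]; rewrite ?rnorm0 ?rnorm_ge0.
Qed.

Definition trunc (N : nat) x : nat -> E := fun j => if (j < N)%N then x j else 0%R.

Lemma enorm_trunc_le_sum N x :
  enorm (trunc N x) <= (\sum_(j < N) rnorm (x j))%:E.
Proof.
elim: N => [|N IH]; first by rewrite big_ord0 (_ : trunc 0 x = fun=> 0%R) ?enorm0.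
rewrite big_ord_recr EFinD -(enorm_single _ N).
apply: le_trans (leeD IH (lexx _)); apply: le_trans (enormD _ _).
apply: le_enorm => j; rewrite /trunc /= ltnS leq_eqVlt.
by case: eqP => [->|_] /=; rewrite ?ltnn ?add0r ?addr0.
Qed.

Lemma enorm_le_trunc x (M : \bar R) :
  (forall N, enorm (trunc N x) <= M) -> enorm x <= M.
Proof.
move=> xM; have M0 : 0 <= M by exact: le_trans (enorm_ge0 _) (xM 0%N).
have Mp : M = (M `^ p) `^ p^-1 by rewrite -poweRrM mulfV// poweRe1.
rewrite Mp; apply: gt0_ler_poweR.
- by rewrite invr_ge0 ltW.
- by rewrite in_itv/= power_sum_ge0 leey.
- by rewrite in_itv/= poweR_ge0 leey.
apply: lime_le.
  by apply: is_cvg_nneseries => j _ _; rewrite lee_fin powR_ge0.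
apply: nearW => N.
have /(gt0_ler_poweR (ltW p0)) := xM N.
rewrite !in_itv/= enorm_ge0 M0 !leey => /(_ isT isT).
rewrite /enorm -poweRrM mulVf// poweRe1 ?power_sum_ge0//; apply: le_trans.
rewrite /power_sum (nneseries_split 0 N); last by move=> j _; rewrite lee_fin powR_ge0.
rewrite add0n [X in _ <= _ + X]eseries0 ?adde0.
  by rewrite big_nat [X in _ <= X]big_nat lee_sum// => j /andP[_ jN]; rewrite /trunc jN.
by move=> j Nj _; rewrite /trunc ltnNge Nj/= rnorm0 powR0.
Qed.

End SequenceNorm.

Section Lp.
Variables (R : realType) (k : scalar_kind) (p : R).
Local Notation K := (scalars R k).

Definition lp_pred (p1 : 1 <= p) : {pred nat -> K^o} :=
  mem (seq_l p K^o).

(* The Banach space l_p of scalar sequences, p >= 1. *)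
Record lp (p1 : 1 <= p) := Lp {
  lp_seq :> nat -> K^o;
  lp_seqP : lp_seq \in lp_pred p1 }.

Variable p1 : 1 <= p.

HB.instance Definition _ := [isSub for @lp_seq p1].
HB.instance Definition _ := [Choice of lp p1 by <:].

Lemma lp_submod_closed : submod_closed (lp_pred p1).
Proof.
split.
  rewrite inE /= /seq_l /= -(enorm_lty p1).
  by rewrite (_ : (0 : nat -> K^o) = fun=> 0) ?enorm0// ltry.
move=> a x y; rewrite !inE /seq_l /= -!(enorm_lty p1) => xoo yoo.
apply: le_lt_trans (enormD p1 (a \*: x) y) _.
by rewrite (enormZ p1) lte_add_pinfty// lte_mul_pinfty ?lee_fin
  -?(ler_of_real k) ?of_real0 ?realpart_ge0K.
Qed.

HB.instance Definition _ :=
  GRing.isSubmodClosed.Build _ _ (lp_pred p1) lp_submod_closed.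
HB.instance Definition _ := [SubChoice_isSubLmodule of lp p1 by <:].

End Lp.
Arguments lp {R} k {p} p1.

(* Locked: unfolding the power function makes failing unification problems on
   norms diverge. *)
HB.lock Definition lp_norm (R : realType) (k : scalar_kind) (p : R)
    (p1 : 1 <= p) (x : lp k p1) : R :=
  fine (power_sum p (lp_seq x)) `^ p^-1.
Canonical lp_norm_unlockable := Unlockable lp_norm.unlock.
Arguments lp_norm {R k p p1} x.

Section LpNorm.
Variables (R : realType) (k : scalar_kind) (p : R).
Hypothesis p1 : 1 <= p.
Local Notation K := (scalars R k).
Local Notation lp := (@lp R k p p1).

Lemma lp_norm_enorm (x : lp) : (lp_norm x)%:E = enorm p x.
Proof.
rewrite /enorm unlock -poweR_EFin fineK// ge0_fin_numE ?power_sum_ge0//.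
by have := lp_seqP x; rewrite inE.
Qed.

Lemma lp_normD (x y : lp) :
  of_real k (lp_norm (x + y)) <= of_real k (lp_norm x) + of_real k (lp_norm y).
Proof.
rewrite -(of_realD k) (ler_of_real k) -lee_fin EFinD !lp_norm_enorm.
exact: (enormD p1 (lp_seq x) (lp_seq y)).
Qed.

Lemma lp_normZ (a : K) (x : lp) :
  of_real k (lp_norm (a *: x)) = `|a| * of_real k (lp_norm x).
Proof.
rewrite -(realpart_ge0K (normr_ge0 a)) -of_realM; congr of_real.
by apply: EFin_inj; rewrite EFinM !lp_norm_enorm -(enormZ p1).
Qed.

Lemma lp_norm0_eq0 (x : lp) : of_real k (lp_norm x) = 0 -> x = 0.
Proof.
move=> /(congr1 (@realpart R k)); rewrite of_realK realpart0 => x0.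
apply: val_inj; apply/funext => j; apply/rnorm_eq0/le_anti.
rewrite rnorm_ge0 andbT -lee_fin -x0 lp_norm_enorm.
exact: (rnorm_le_enorm p1).
Qed.

HB.instance Definition _ :=
  Lmodule_isNormed.Build K lp lp_normD lp_normZ lp_norm0_eq0.

Lemma lp_normE (x : lp) : `|x| = of_real k (lp_norm x).
Proof. by []. Qed.

Lemma lp_seqB (x y : lp) j : lp_seq (x - y) j = lp_seq x j - lp_seq y j.
Proof. by []. Qed.

Lemma lp_complete (F : set_system lp) :
  ProperFilter F -> cauchy F -> cvg F.
Proof.
move=> FF /cauchy_ballP Fc.
have {}Fc e : 0 < e -> exists2 A : set lp, F A &
    forall x y, A x -> A y -> lp_norm (x - y) <= e.
  move=> e0; have e20 : 0 < of_real k (e / 2).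
    by rewrite -(of_real0 R k) ltr_of_real divr_gt0.
  have [[A B] /= [FA FB] AB] := Fc _ e20.
  exists A => // x y Ax Ay; have [z Bz] := filter_ex FB.
  have := AB (x, z) (conj Ax Bz); have := AB (y, z) (conj Ay Bz).
  rewrite -!ball_normE /= !lp_normE !ltr_of_real => yz xz.
  rewrite -lee_fin lp_norm_enorm.
  have -> : lp_seq (x - y) = (lp_seq (x - z) \+ lp_seq (z - y))%R.
    apply/funext => j.
    by rewrite -[RHS]/(lp_seq (x - z) j + lp_seq (z - y) j) !lp_seqB subrKA.
  apply: le_trans (enormD p1 _ _) _; rewrite -!lp_norm_enorm -EFinD lee_fin.
  rewrite [leRHS]splitr lerD ?ltW//.
  by rewrite -(ltr_of_real k) -lp_normE distrC lp_normE ltr_of_real.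
have Fj j : cvg ((fun x : lp => lp_seq x j) @ F : set_system K^o).
  apply: scalars_complete; apply/cauchy_ballP => e e0.
  have eE := realpart_ge0K (ltW e0).
  have e20 : 0 < realpart e / 2.
    by rewrite divr_gt0// -(ltr_of_real k) of_real0 eE.
  have [A FA AA] := Fc _ e20.
  have FjA : ((fun x : lp => lp_seq x j) @ F)
      ((fun x : lp => lp_seq x j) @` A).
    have AA' : A `<=`
        (fun x : lp => lp_seq x j) @^-1` ((fun x : lp => lp_seq x j) @` A).
      by move=> z Az; exists z.
    exact: (filterS AA' FA).
  exists ((fun x : lp => lp_seq x j) @` A, (fun x : lp => lp_seq x j) @` A) => //.
  move=> [_ _] /= [[x Ax <-] [y Ay <-]]; rewrite -ball_normE /=.
  rewrite -eE -[`|_|]rnormK ltr_of_real.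
  apply: (@le_lt_trans _ _ (realpart e / 2)); last by rewrite gtr_pMr ?invf_lt1 ?ltr1n//; rewrite -(ltr_of_real k) of_real0 eE.
  apply: le_trans (AA _ _ Ax Ay).
  by rewrite -lee_fin lp_norm_enorm; exact: (rnorm_le_enorm p1 (lp_seq (x - y)) j).
have /choice[l Fl] : forall j, exists c : K^o,
    (fun x : lp => lp_seq x j) @ F --> c.
  by move=> j; move/cvg_ex : (Fj j).
have Fle e : 0 < e -> exists2 A : set lp, F A &
    forall x, A x -> (enorm p (lp_seq x - l)%R <= e%:E)%E.
  move=> e0; have [A FA AA] := Fc _ e0; exists A => // x Ax.
  apply: (enorm_le_trunc p1) => N; apply/lee_addgt0Pr => d d0.
  have dN0 : 0 < d / N.+1%:R by rewrite divr_gt0.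
  have FN m : F [set y : lp | forall j, (j < m)%N ->
      rnorm (lp_seq y j - l j) < d / N.+1%:R].
    elim: m => [|m IH]; first by apply: filterS filterT => y _ j.
    have dK : 0 < of_real k (d / N.+1%:R) by rewrite -(of_real0 R k) ltr_of_real.
    move/cvgrPdist_lt : (Fl m) => /(_ _ dK) Fm.
    apply: filterS2 IH Fm => y IH ym j; rewrite ltnS leq_eqVlt => /predU1P[->|]; last exact: IH.
    by rewrite -(ltr_of_real k) rnormK distrC.
  have [y [Ay yN]] := filter_ex (filterI FA (FN N)).
  have xyl : trunc N (lp_seq x - l)%R =
      (trunc N (lp_seq (x - y)) \+ trunc N (lp_seq y - l))%R.
    apply/funext => j; rewrite /trunc /=; case: ifP => _; last by rewrite addr0.
    by rewrite -[LHS]/(lp_seq x j - l j) -[RHS]/(lp_seq x j - lp_seq y j + (lp_seq y j - l j)) subrKA.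
  rewrite xyl; apply: le_trans (enormD p1 _ _) _; apply: leeD.
    apply: (@le_trans _ _ (enorm p (lp_seq (x - y)))).
      by apply: (le_enorm p1) => j; rewrite /trunc; case: ifP => // _; rewrite rnorm0 rnorm_ge0.
    by rewrite -lp_norm_enorm lee_fin AA.
  apply: le_trans (enorm_trunc_le_sum p1 _ _) _; rewrite lee_fin.
  apply: (@le_trans _ _ (\sum_(j < N) d / N.+1%:R)).
    by apply: ler_sum => j _; rewrite ltW// yN.
  rewrite sumr_const card_ord -[_ *+ N]mulr_natr -mulrA ger_pMr//.
  by rewrite ler_pdivrMl// mulr1 ler_nat.
have [A FA AA] := Fle 1 ltr01.
have [x Ax] := filter_ex FA.
have lP : l \in lp_pred p1.
  have xl : (lp_seq x - l)%R \in lp_pred p1.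
    by rewrite inE /= /seq_l /= -(enorm_lty p1) (le_lt_trans (AA _ Ax))// ltry.
  by rewrite -[l](subKr (lp_seq x)) rpredB// lp_seqP.
apply/cvg_ex; exists (Lp lP); apply/cvgrPdist_lt => /= e e0.
have eE := realpart_ge0K (ltW e0).
have e20 : 0 < realpart e / 2.
  by rewrite divr_gt0// -(ltr_of_real k) of_real0 eE.
have [B FB BB] := Fle _ e20.
apply: filterS FB => y By; rewrite distrC lp_normE -eE ltr_of_real.
apply: (@le_lt_trans _ _ (realpart e / 2)); last by rewrite gtr_pMr ?invf_lt1 ?ltr1n//; rewrite -(ltr_of_real k) of_real0 eE.
by rewrite -lee_fin lp_norm_enorm; exact: BB.
Qed.

HB.instance Definition _ := Uniform_isComplete.Build lp lp_complete.

End LpNorm.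

(* Main.v *)
Require Import Defs.
From HB Require Import structures.
From mathcomp Require Import all_boot all_order all_algebra.
From mathcomp Require Import complex.
From mathcomp Require Import all_classical all_reals all_analysis.
From mathcomp Require Import lra ring.
Import Order.TTheory GRing.Theory Num.Theory.
Import numFieldNormedType.Exports.
Local Open Scope classical_set_scope.
Local Open Scope ring_scope.

(** This is an extrapolation theorem in the manner of Maurey, and its core is
    linear.  Call mixture of functionals a sequence [psi] of bounded
    functionals on [X] whose norms have p-th powers of sum at most 1; it is
    an operator from [X] into [l_p], and its mass at [x] is the p-th power of
    the norm of the image of [x].  Mixtures play the part of probability
    measures on the dual unit ball, the mass being an integral of
    [|f x| ^ p], and this avoids weak-star topology, Hahn-Banach and Pietsch
    domination.

    The hypothesis says that mixtures are r-summing: a mixture is p-summing,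
    hence so is the n-linear mapping obtained by multiplying it with copies of
    one functional, and the r/n-summability of that mapping on suitable
    sequences gives back the r-summability of the mixture
    ([mixture_r_summable]).  Mixtures and weights are closed under countable
    mixing, so the r-summing inequality holds with one constant for all of
    them ([mixture_r_summing_constant]).

    Now let [x] be weakly 1-summable.  Among the mixtures, choose one that
    nearly maximizes the sum over [j < N] of the weights [t j], the p-th roots
    of its masses at [x j].  The first-order condition says that the sums of
    [t j ^ (1 - p) * |f (x j)| ^ p] over the dual ball are controlled by
    [Z], the sum of the weights ([exists_near_maximal_mixture]).
    Interpolating r between 1 and p, and applying the r-summing constant with
    weights [t j ^ (1 - r)], bounds [Z] by a power of itself with exponent
    less than 1, so [Z] is bounded independently of [N]
    ([finite_extrapolation_weights]).  A limit of these weights splits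
    [x j] as [t j ^ (1 - 1/p)] times [y j] with [t] summable and [y] weakly
    p-summable ([seq_lw1_factorization]).

    If [T] is summing for p, splitting each of its n arguments in this way and
    using Hoelder's inequality makes it summing for 1.  The other inclusion
    holds for every [X]: multiplying weakly p-summable sequences by scalars in
    the dual exponent makes them weakly 1-summable, and Landau's theorem on
    scalar sequences removes the multipliers ([L_as_1_sub]). *)

Set Implicit Arguments.
Unset Strict Implicit.
Unset Printing Implicit Defensive.

(** * Elementary inequalities *)

Section Inequalities.
Variable R : realType.
Implicit Types x y s : R.

Lemma geo_mean_le_add x y s : 0 <= x -> 0 <= y -> 0 <= s <= 1 ->
  x `^ (1 - s) * y `^ s <= x + y.
Proof.
move=> x0 y0 /andP[s0 s1]; set m := Num.max x y.
have m0 : 0 <= m by rewrite le_max x0.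
have -> : x + y = m + Num.min x y by rewrite addr_max_min.
apply: (@le_trans _ _ m); last by rewrite lerDl le_min x0.
have -> : m = m `^ (1 - s) * m `^ s by rewrite -powRD subrK ?powRr1// oner_eq0.
by apply: ler_pM; rewrite ?powR_ge0// ge0_ler_powR ?nnegrE ?subr_ge0// le_max lexx ?orbT.
Qed.

Lemma powR_le_tangent x s : 0 <= x -> 0 < s < 1 -> x `^ s <= 1 + s * (x - 1).
Proof.
move=> x0 /andP[s0 s1].
have := @conjugate_powR R (x `^ s) 1 s^-1 (1 - s)^-1 (powR_ge0 _ _) ler01.
rewrite !invr_gt0 subr_gt0 !invrK subrKC => /(_ s0 s1 erefl).
rewrite -powRrM divff ?gt_eqF// powRr1// powR1 mulr1 => /le_trans; apply; lra.
Qed.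

Lemma powR_add_le x y s : 0 <= x -> 0 <= y -> 0 <= s <= 1 ->
  (x + y) `^ s <= 2 * (x `^ s + y `^ s).
Proof.
move=> x0 y0 /andP[s0 s1]; set m := Num.max x y.
have m0 : 0 <= m by rewrite le_max x0.
have xm : x <= m by rewrite le_max lexx.
have ym : y <= m by rewrite le_max lexx orbT.
apply: (@le_trans _ _ ((2 * m) `^ s)).
  by rewrite ge0_ler_powR ?nnegrE ?addr_ge0 ?mulr_ge0//; lra.
rewrite powRM//; apply: ler_pM; rewrite ?powR_ge0//.
  by rewrite -[leRHS]powRr1// ler_powR// ler1n.
rewrite /m; case: (leP x y) => _; [rewrite lerDr|rewrite lerDl]; exact: powR_ge0.
Qed.

Lemma nneseries_ltyP (f : nat -> R) : (forall j, 0 <= f j) ->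
  (\sum_(0 <= j <oo) (f j)%:E < +oo)%E <->
  exists B, forall N, \sum_(0 <= j < N) f j <= B.
Proof.
move=> f0; split=> [foo|[B fB]].
  exists (fine (\sum_(0 <= j <oo) (f j)%:E)%E) => N.
  rewrite -lee_fin fineK; last first.
    by rewrite ge0_fin_numE// nneseries_ge0// => j _ _; rewrite lee_fin.
  rewrite -sumEFin; apply: nneseries_lim_ge => j _ _; rewrite lee_fin//.
apply: (@le_lt_trans _ _ B%:E); last exact: ltry.
apply: lime_le; first by apply: is_cvg_nneseries => j _ _; rewrite lee_fin.
by apply: nearW => N; rewrite sumEFin lee_fin.
Qed.

Lemma sum_partial_le (f : nat -> R) M N : (forall j, 0 <= f j) -> (M <= N)%N ->
  \sum_(0 <= j < M) f j <= \sum_(0 <= j < N) f j.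
Proof.
move=> f0 MN; rewrite [leRHS](big_cat_nat (n := M))//= lerDl sumr_ge0//.
Qed.

Lemma sum_half_pow N : \sum_(0 <= j < N) (2^-1 : R) ^+ j.+1 <= 1.
Proof.
suff -> : \sum_(0 <= j < N) (2^-1 : R) ^+ j.+1 = 1 - 2^-1 ^+ N.
  by rewrite lerBlDr lerDl exprn_ge0.
elim: N => [|N IH]; first by rewrite big_geq// subrr.
by rewrite big_nat_recr//= IH exprS; lra.
Qed.

Lemma nneseries_half_pow : (\sum_(0 <= m <oo) (((2^-1 : R) ^+ m.+1)%:E) <= 1)%E.
Proof.
apply: lime_le; first by apply: is_cvg_nneseries => j _ _; rewrite lee_fin exprn_ge0.
by apply: nearW => N; rewrite sumEFin lee_fin sum_half_pow.
Qed.

End Inequalities.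

(** * Boundedness from closure under countable mixtures *)

(** A uniform boundedness principle without topology: a sequence on which [G]
    grows like [8 ^+ m] would be mixed into one point where [G] is infinite.
    It plays the part of the closed graph theorem: [P] need not be linear, it
    is enough that its elements can be averaged with dyadic weights. *)
Lemma bounded_of_mixture (R : realType) (T : Type) (P : set T) (G : T -> \bar R) :
  (forall a : nat -> T, (forall m, P (a m)) ->
     exists2 b, P b & forall m, (G (a m) <= (4 ^+ m.+1)%:E * G b)%E) ->
  (forall a, P a -> (G a < +oo)%E) ->
  exists2 C : R, 0 <= C & forall a, P a -> (G a <= C%:E)%E.
Proof.
move=> mix fin; apply: contrapT => /forall2NP unb.
have /choice[a aP] : forall m, exists a, P a /\ (((8 : R) ^+ m.+1)%:E < G a)%E.
  move=> m; have [|H] := unb (8 ^+ m.+1); first by rewrite exprn_ge0.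
  move/existsNP : H => [a /not_implyP[Pa /negP]]; rewrite -ltNge => H.
  by exists a.
have [b Pb ab] := mix a (fun m => (aP m).1).
have b_ge m : (((2 : R) ^+ m.+1)%:E <= G b)%E.
  rewrite -(@lee_pmul2l _ (4 ^+ m.+1)%:E) ?lte_fin ?exprn_gt0//.
  apply: le_trans (ab m); rewrite -EFinM -exprMn (_ : 4 * 2 = 8); last by ring.
  exact: ltW (aP m).2.
have := fin b Pb; move: b_ge; case: (G b) => [g|//|/(_ 0%N)//] b_ge _.
have [m gm] : exists m : nat, g < m%:R.
  by exists (Num.truncn g).+1; rewrite truncnS_gt.
have := b_ge m; rewrite lee_fin leNgt => /negP; apply.
apply: (lt_trans gm); rewrite -natrX ltr_nat.
by rewrite (leq_trans (ltn_expl m (ltnSn 1)))// leq_exp2l.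
Qed.

Lemma dyadic_mixture (R : realType) (a : nat -> nat -> R) (c : nat -> R) :
    (forall m j, 0 <= a m j <= c j) ->
  exists b : nat -> R, [/\ forall j, 0 <= b j <= c j,
    forall m j, a m j <= 2 ^+ m.+1 * b j &
    forall j, (b j)%:E = (\sum_(0 <= m <oo) ((2^-1) ^+ m.+1 * a m j)%:E)%E].
Proof.
move=> ac.
have a0 m j : 0 <= a m j by have /andP[] := ac m j.
have c0 j : 0 <= c j by have /andP[/le_trans] := ac 0%N j; apply.
pose bE j := (\sum_(0 <= m <oo) ((2^-1) ^+ m.+1 * a m j)%:E)%E.
have t0 m j : 0 <= (2^-1) ^+ m.+1 * a m j by rewrite mulr_ge0 ?exprn_ge0.
have bEc j : (bE j <= (c j)%:E)%E.
  apply: (@le_trans _ _ (\sum_(0 <= m <oo) (c j)%:E * ((2^-1) ^+ m.+1)%:E)%E).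
    apply: lee_nneseries => m _; first by rewrite lee_fin.
    by rewrite -EFinM lee_fin mulrC ler_wpM2r ?exprn_ge0//; have /andP[] := ac m j.
  rewrite nneseriesZl; last by move=> m _; rewrite lee_fin exprn_ge0.
  by rewrite -[leRHS]mule1 lee_wpmul2l ?lee_fin// nneseries_half_pow.
have bE0 j : (0 <= bE j)%E by apply: nneseries_ge0 => m _ _; rewrite lee_fin.
have bEK j : (fine (bE j))%:E = bE j.
  by rewrite fineK// ge0_fin_numE// (le_lt_trans (bEc j)) ?ltry.
exists (fun j => fine (bE j)); split=> // [j|m j].
  by rewrite fine_ge0//= -lee_fin bEK.
rewrite -ler_pdivrMl ?exprn_gt0// -exprVn -lee_fin bEK /bE.
rewrite (@nneseriesD1 _ _ m)//=; last by move=> i _; rewrite lee_fin.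
by rewrite leeDl// nneseries_ge0// => i _ _; rewrite lee_fin.
Qed.

(** Landau's theorem: for [s = p^-1] and [w j = c j `^ p] it says that a
    sequence [c] which multiplies the dual space of [l_p] into [l_1] is in
    [l_p].  Mixing makes the hypothesis uniform over the unit ball of [l_1],
    and the uniform bound is tested on the normalized truncations of [w]. *)
Lemma summable_of_geo_means (R : realType) (s : R) (w : nat -> R) :
    0 < s <= 1 -> (forall j, 0 <= w j) ->
    (forall u : nat -> R, (forall j, 0 <= u j) ->
       (\sum_(0 <= j <oo) (u j)%:E < +oo)%E ->
       (\sum_(0 <= j <oo) (u j `^ (1 - s) * w j `^ s)%:E < +oo)%E) ->
  (\sum_(0 <= j <oo) (w j)%:E < +oo)%E.
Proof.
move=> /andP[s0 s1] w0 H.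
pose P := [set u : nat -> R | (forall j, 0 <= u j <= 1) /\
  (\sum_(0 <= j <oo) (u j)%:E <= 1)%E].
pose G (u : nat -> R) := (\sum_(0 <= j <oo) (u j `^ (1 - s) * w j `^ s)%:E)%E.
have [||C C0 GC] := @bounded_of_mixture R _ P G.
- move=> a aP.
  have a0 m j : 0 <= a m j by have /andP[] := (aP m).1 j.
  have [b [b01 ab bE]] := @dyadic_mixture R a (fun=> 1) (fun m => (aP m).1).
  have b0 j : 0 <= b j by have /andP[] := b01 j.
  exists b.
    split=> //; under eq_eseriesr do rewrite bE.
    rewrite nneseries_interchange; last first.
      by move=> *; rewrite lee_fin mulr_ge0 ?exprn_ge0.
    apply: le_trans (@nneseries_half_pow R); apply: lee_nneseries => m _.
      by move=> _; apply: nneseries_ge0 => j _ _; rewrite lee_fin mulr_ge0 ?exprn_ge0.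
    under eq_eseriesr do rewrite EFinM.
    rewrite nneseriesZl; last by move=> j _; rewrite lee_fin.
    by rewrite -[leRHS]mule1 lee_wpmul2l ?lee_fin ?exprn_ge0//; exact: (aP m).2.
  move=> m; rewrite /G -nneseriesZl; last first.
    by move=> j _; rewrite lee_fin mulr_ge0 ?powR_ge0.
  apply: lee_nneseries => j _; first by rewrite lee_fin mulr_ge0 ?powR_ge0.
  rewrite -EFinM lee_fin mulrA ler_wpM2r ?powR_ge0//.
  have -> : (4 : R) ^+ m.+1 = 2 ^+ m.+1 * 2 ^+ m.+1 by rewrite -exprMn; congr (_ ^+ _); ring.
  apply: (@le_trans _ _ ((2 ^+ m.+1 * b j) `^ (1 - s))).
    by rewrite ge0_ler_powR ?nnegrE ?subr_ge0 ?mulr_ge0 ?exprn_ge0.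
  rewrite powRM ?exprn_ge0// ler_wpM2r ?powR_ge0//.
  have two1 : 1 <= (2 : R) ^+ m.+1 by rewrite exprn_ege1// ler1n.
  apply: (@le_trans _ _ (2 ^+ m.+1)); first by rewrite ler1_powR// gerBl ltW.
  by rewrite ler_peMl// exprn_ge0.
- move=> u [u01 u1]; apply: H => [j|]; first by have /andP[] := u01 j.
  exact: le_lt_trans u1 (ltry _).
apply/(nneseries_ltyP w0); exists (C `^ s^-1) => N; set W := \sum_(_ <= _ < _) _.
have W0 : 0 <= W by apply: sumr_ge0.
have [->|Wn0] := eqVneq W 0; first exact: powR_ge0.
have Wp : 0 < W by rewrite lt0r Wn0.
suff WC : W `^ s <= C.
  rewrite -[leLHS]powRr1// -(@divff _ s) ?gt_eqF// powRrM.
  by rewrite ge0_ler_powR ?nnegrE ?powR_ge0// invr_ge0 ltW.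
pose u j := if (j < N)%N then w j / W else 0.
have u0 j : 0 <= u j by rewrite /u; case: ifP => // _; rewrite divr_ge0.
have uP : P u.
  have su : (\sum_(0 <= j <oo) (u j)%:E <= 1)%E.
    rewrite (nneseries_split 0 N); last by move=> j _; rewrite lee_fin.
    rewrite add0n [X in (_ + X)%E]eseries0 ?adde0; last first.
      by move=> j Nj _; rewrite /u ltnNge Nj.
    rewrite sumEFin lee_fin big_nat (eq_bigr (fun j => w j / W)); last first.
      by move=> j /andP[_ jN]; rewrite /u jN.
    by rewrite -big_nat -mulr_suml divff.
  split=> // j; rewrite u0/= -lee_fin; apply: le_trans su.
  rewrite (@nneseriesD1 _ _ j)//=; last by move=> i _; rewrite lee_fin.
  by rewrite leeDl// nneseries_ge0// => i _ _; rewrite lee_fin.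
have := GC _ uP; rewrite /G (nneseries_split 0 N); last first.
  by move=> j _; rewrite lee_fin mulr_ge0 ?powR_ge0.
rewrite add0n sumEFin => /(le_trans _) H1; rewrite -lee_fin; apply: H1.
apply: (@le_trans _ _ (\sum_(0 <= k < N) (u k `^ (1 - s) * w k `^ s))%:E); last first.
  by rewrite leeDl// nneseries_ge0// => j _ _; rewrite lee_fin mulr_ge0 ?powR_ge0.
rewrite lee_fin big_nat (eq_bigr (fun j => w j * W `^ (s - 1))); last first.
  move=> j /andP[_ jN]; rewrite /u jN powRM ?invr_ge0//.
  rewrite mulrAC -powRD; last by rewrite subrK oner_eq0.
  by rewrite subrK powRr1// -powR_inv1// -powRrM mulN1r opprB.
by rewrite -big_nat -mulr_suml -/W mulr_powRB1.
Qed.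

(** * Bounded functionals and weakly summable sequences *)

Section BoundedMaps.
Variables (R : realType) (k : scalar_kind).
Local Notation K := (scalars R k).

Lemma realpart_norm_of_real (c : R) : realpart `|of_real k c| = `|c|.
Proof.
case: k => //; change (complex.Re `|real_complex R c| = `|c|).
by rewrite normc_def /= expr0n /= addr0 sqrtr_sqr.
Qed.

Lemma rnorm_of_realZ (E : normedModType K) (c : R) (x : E) :
  rnorm (of_real k c *: x) = `|c| * rnorm x.
Proof. by rewrite rnormZ realpart_norm_of_real. Qed.

Lemma rnormN (E : normedModType K) (x : E) : rnorm (- x) = rnorm x.
Proof. by rewrite /rnorm normrN. Qed.

Lemma rnormM (x y : K^o) : rnorm (x * y : K^o) = rnorm x * rnorm y.
Proof. exact: rnormZ. Qed.

Lemma of_real1 : of_real k (1 : R) = 1.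
Proof. by case: k. Qed.

Lemma of_realN (c : R) : of_real k (- c) = - of_real k c.
Proof. by apply/eqP; rewrite -addr_eq0 -of_realD addNr of_real0. Qed.

Lemma norm_le_rnorm (E F : normedModType K) (c : R) (x : E) (y : F) :
  (`|x| <= of_real k c * `|y|) = (rnorm x <= c * rnorm y).
Proof. by rewrite -(rnormK x) -(rnormK y) -of_realM ler_of_real. Qed.

Definition bounded_by (E F : normedModType K) (c : R) (f : E -> F) : Prop :=
  linear f /\ forall x, rnorm (f x) <= c * rnorm x.

Section Linear.
Variables (E F : normedModType K) (f : E -> F) (lf : linear f).

Lemma linearPZ a x : f (a *: x) = a *: f x.
Proof.
have f0 : f 0 = 0.
  by have := lf (-1) 0 0; rewrite scaler0 addr0 scaleN1r addNr.
by have := lf a x 0; rewrite !addr0 f0 addr0.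
Qed.

(** Weak summability quantifies over bundled linear maps, while functionals are
    built below as plain functions. *)
Lemma linear_bundle : exists g : {linear E -> F}, (g : E -> F) = f.
Proof.
pose g : {linear E -> F} := HB.pack f (GRing.isLinear.Build K E F *:%R f lf).
by exists g.
Qed.

End Linear.

Lemma bounded_by_continuous (E F : normedModType K) c (f : E -> F) :
  bounded_by c f -> continuous f.
Proof.
move=> [lf fc]; have [g gf] := linear_bundle lf; rewrite -gf.
apply/bounded_linear_continuous/linear_boundedP.
have c0 : 0 <= of_real k `|c| by rewrite -(of_real0 R k) ler_of_real.
exists (of_real k `|c|); split; first exact: ger0_real.
move=> M /ltW cM x; apply: le_trans (ler_wpM2r (normr_ge0 _) cM).
rewrite norm_le_rnorm gf (le_trans (fc x))// ler_wpM2r ?rnorm_ge0//.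
exact: ler_norm.
Qed.

Lemma continuous_bounded_by (E F : normedModType K) (f : {linear E -> F}) :
  continuous f -> exists2 c, 0 <= c & bounded_by c f.
Proof.
move=> /linear_bounded_continuous/linear_boundedP/pinfty_ex_gt0[M M0 fM].
have ME := realpart_ge0K (ltW M0).
exists (realpart M); first by rewrite -(ler_of_real k) of_real0 ME ltW.
by split=> [|x]; [exact: linearP|rewrite -norm_le_rnorm ME].
Qed.

Lemma bounded_byZ (E F : normedModType K) c d (f : E -> F) :
  bounded_by c f -> bounded_by (`|d| * c) (fun x => of_real k d *: f x).
Proof.
move=> [lf fc]; split=> [a x y|x]; last first.
  by rewrite rnorm_of_realZ -mulrA ler_wpM2l.
by rewrite lf scalerDr !scalerA [_ * a]mulrC.
Qed.

Lemma bounded_by0 (E F : normedModType K) c : 0 <= c ->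
  bounded_by c ((fun=> 0) : E -> F).
Proof.
move=> c0; split=> [a x y|x]; first by rewrite scaler0 addr0.
by rewrite rnorm0 mulr_ge0// rnorm_ge0.
Qed.

Lemma scalars_cauchy_cvg (u : nat -> K^o) :
    (forall e : R, 0 < e -> exists m0, forall m, (m0 <= m)%N ->
       rnorm (u m - u m0) <= e) ->
  exists l : K^o, forall e : R, 0 < e -> exists m0, forall m, (m0 <= m)%N ->
       rnorm (l - u m) <= e.
Proof.
move=> uc.
have /cvg_ex[l ul] : cvg (u @ \oo : set_system K^o).
  apply: scalars_complete; apply/cauchy_ballP => e e0.
  have eE := realpart_ge0K (ltW e0).
  have e3 : 0 < realpart e / 3.
    by rewrite divr_gt0// -(ltr_of_real k) of_real0 eE.
  have [m0 um] := uc _ e3.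
  have A_oo : (u @ \oo) (u @` [set m | (m0 <= m)%N]).
    by exists m0 => // m /= m0m; exists m.
  exists (u @` [set m | (m0 <= m)%N], u @` [set m | (m0 <= m)%N]) => //.
  move=> [_ _] /= [[i /um i3 <-] [j /um j3 <-]]; rewrite -ball_normE /=.
  rewrite -eE -[`|_|]rnormK ltr_of_real -(subrKA (u m0)).
  apply: le_lt_trans (rnormD _ _) _; rewrite -[rnorm (u m0 - _)]rnormN opprB.
  by apply: le_lt_trans (lerD i3 j3) _; lra.
exists l => e e0; have eK : 0 < of_real k e by rewrite -(of_real0 R k) ltr_of_real.
move/cvgrPdist_le : ul => /(_ _ eK)[m0 _ um]; exists m0 => m m0m.
by rewrite -(ler_of_real k) rnormK; exact: um.
Qed.

End BoundedMaps.

(** Locked: failing unification problems between norms would otherwise unfold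
    the power function and diverge. *)
HB.lock Definition trunc_norm (R : realType) (k : scalar_kind) (t : R)
    (E : normedModType (scalars R k)) (N : nat) (z : nat -> E) : R :=
  (\sum_(0 <= j < N) rnorm (z j) `^ t) `^ t^-1.

Section TruncatedNorm.
Variables (R : realType) (k : scalar_kind) (t : R).
Hypothesis t1 : 1 <= t.
Local Notation K := (scalars R k).
Variable E : normedModType K.
Implicit Types z : nat -> E.

Let t0 : 0 < t. Proof. exact: lt_le_trans t1. Qed.

Local Notation trunc_norm := (trunc_norm t).

Lemma trunc_normE N z : (trunc_norm N z)%:E = enorm t (trunc N z).
Proof.
rewrite /enorm /power_sum (nneseries_split 0 N); last first.
  by move=> j _; rewrite lee_fin powR_ge0.
rewrite add0n [X in (_ + X)%E]eseries0 ?adde0; last first.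
  by move=> j Nj _; rewrite /trunc ltnNge Nj/= rnorm0 powR0 ?gt_eqF.
rewrite sumEFin poweR_EFin trunc_norm.unlock; congr (_ `^ _)%:E.
by apply: eq_big_nat => j /andP[_ jN]; rewrite /trunc jN.
Qed.

Lemma trunc_norm_powR N z :
  trunc_norm N z `^ t = \sum_(0 <= j < N) rnorm (z j) `^ t.
Proof.
rewrite trunc_norm.unlock -powRrM mulVf ?gt_eqF// powRr1// sumr_ge0// => j _; exact: powR_ge0.
Qed.

Lemma trunc_norm_ge0 N z : 0 <= trunc_norm N z.
Proof. by rewrite trunc_norm.unlock powR_ge0. Qed.

Lemma trunc_normD N z z' :
  trunc_norm N (z \+ z') <= trunc_norm N z + trunc_norm N z'.
Proof.
rewrite -lee_fin EFinD !trunc_normE.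
rewrite (_ : trunc N (z \+ z') = (trunc N z \+ trunc N z')); first exact: enormD.
by apply/funext => j; rewrite /trunc /=; case: ifP => // _; rewrite addr0.
Qed.

Lemma trunc_normZ N c z :
  trunc_norm N (fun j => of_real k c *: z j) = `|c| * trunc_norm N z.
Proof.
apply: EFin_inj; rewrite EFinM !trunc_normE -(realpart_norm_of_real k).
rewrite -enormZ//; congr enorm; apply/funext => j; rewrite /trunc /=.
by case: ifP => // _; rewrite scaler0.
Qed.

Lemma trunc_norm_le_sum N z : trunc_norm N z <= \sum_(0 <= j < N) rnorm (z j).
Proof. by rewrite -lee_fin trunc_normE big_mkord enorm_trunc_le_sum. Qed.

End TruncatedNorm.

Section UniformBoundedness.
Variables (R : realType) (k : scalar_kind) (t : R).
Hypothesis t1 : 1 <= t.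
Local Notation K := (scalars R k).
Variable E : normedModType K.
Variable y : nat -> E.
Local Notation q N f := (trunc_norm t N (fun j => (f : E -> K^o) (y j))).

Let t0 : 0 < t. Proof. exact: lt_le_trans t1. Qed.

Lemma exists_near_norming N b (g : E -> K^o) : bounded_by 1 g -> 0 < b -> b <= q N g ->
  exists f : E -> K^o, [/\ bounded_by 1 f, b <= 3 / 2 * q N f &
    forall h : E -> K^o, bounded_by 1 h -> q N h <= 3 / 2 * q N f].
Proof.
move=> g1 b0 bg; pose Q := [set q N h | h in [set h : E -> K^o | bounded_by 1 h]].
have Qub : has_ubound Q.
  exists (\sum_(0 <= j < N) rnorm (y j)) => _ [h [_ h1] <-].
  apply: le_trans (trunc_norm_le_sum t1 N (fun j => h (y j))) _.
  by apply: ler_sum => j _; rewrite -[leRHS]mul1r.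
have supQ : has_sup Q by split => //; exists (q N g); exists g.
have bs : b <= sup Q by apply: le_trans bg _; apply: ub_le_sup => //; exists g.
have s3 : 0 < sup Q / 3 by rewrite divr_gt0// (lt_le_trans b0).
have [_ [f f1 <-] sf] := sup_adherent s3 supQ.
exists f; split=> // [|h h1]; first by apply: le_trans bs _; lra.
have : q N h <= sup Q by apply: ub_le_sup => //; exists h.
move=> /le_trans; apply; lra.
Qed.

(** The uniform boundedness principle on the dual unit ball, needed to know
    that mixtures are p-summing.  If it failed, one could add nearly norming
    functionals [psi m] for faster and faster growing truncated norms, with
    weights [3 ^- m] and signs chosen one after the other.  The weights after
    [m] add up to half of the current one and [psi m] is norming up to a
    factor 3/2, so later terms destroy at most three quarters of what the
    m-th one gained, and the limit has infinite norm. *)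
Lemma seq_lw_bounded : seq_lw t E y ->
  exists2 B, 1 <= B & forall f : E -> K^o, bounded_by 1 f ->
    forall N, \sum_(0 <= j < N) rnorm (f (y j)) `^ t <= B.
Proof.
move=> yw; apply: contrapT => /forall2NP unb.
have /choice[Npsi NpsiP] m : exists Nf : nat * (E -> K^o),
    [/\ bounded_by 1 Nf.2, 6 ^+ m <= q Nf.1 Nf.2 &
     forall h : E -> K^o, bounded_by 1 h -> q Nf.1 h <= 3 / 2 * q Nf.1 Nf.2].
  pose b : R := 3 / 2 * 6 ^+ m.
  have b1 : 1 <= b.
    by have : 1 <= (6 : R) ^+ m by [rewrite exprn_ege1// ler1n]; rewrite /b; lra.
  have bt1 : 1 <= b `^ t.
    have := @ge0_ler_powR R t (ltW t0) 1 b; rewrite powR1 !nnegrE.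
    by apply=> //; lra.
  have [//|] := unb (b `^ t); move=> /existsNP[g /not_implyP[g1 /existsNP[N /negP]]].
  rewrite -ltNge -(trunc_norm_powR t1 N (fun j => g (y j))) => bg.
  have {}bg : b <= q N g.
    rewrite leNgt; apply/negP => gb; move: bg; apply/negP; rewrite -leNgt.
    by rewrite ge0_ler_powR ?nnegrE ?(ltW gb) ?trunc_norm_ge0 ?(ltW t0)//; lra.
  have [|f [f1 bf fm]] := @exists_near_norming N b g g1 _ bg; first by lra.
  by exists (N, f); split=> //=; move: bf; rewrite /b; lra.
pose nn m := (Npsi m).1; pose psi m := (Npsi m).2.
pose w m : R := 3^-1 ^+ m.
have w0 m : 0 < w m by rewrite exprn_gt0.
have wS m : w m.+1 = w m / 3 by rewrite /w exprSr.
(* One of the two signs does not decrease the norm below that of the new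
   summand, since the difference of both choices is twice that summand. *)
pose sgn m (f : E -> K^o) : R :=
  if w m * q (nn m) (psi m) <= q (nn m) (fun x => f x + of_real k (w m) *: psi m x)
  then w m else - w m.
pose step m (f : E -> K^o) : E -> K^o := fun x => f x + of_real k (sgn m f) *: psi m x.
pose fix phi m : E -> K^o := if m is m'.+1 then step m' (phi m') else fun=> 0.
have sgnE m f : `|sgn m f| = w m by rewrite /sgn; case: ifP => _; rewrite ?normrN gtr0_norm.
have psi1 m : bounded_by 1 (psi m) by have [] := NpsiP m.
have stepq m (f : E -> K^o) : w m * q (nn m) (psi m) <= q (nn m) (step m f).
  rewrite /step /sgn; case: ifPn => //; rewrite -ltNge => lt1.
  have := trunc_normD t1 (nn m) (fun j => f (y j) + of_real k (w m) *: psi m (y j))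
    (fun j => of_real k (- 1) *: (f (y j) + of_real k (- w m) *: psi m (y j))).
  rewrite (trunc_normZ t1 (nn m) (- 1)) normrN1 mul1r.
  rewrite (_ : _ \+ _ = fun j => of_real k (2 * w m) *: psi m (y j)); last first.
    apply/funext => j /=.
    rewrite !of_realN of_real1 scaleN1r opprD scaleNr opprK addrACA subrr add0r.
    by rewrite -scalerDl -of_realD mulr_natl mulr2n.
  rewrite (trunc_normZ t1) gtr0_norm ?mulr_gt0//; lra.
have phil m : linear (phi m : E -> K^o).
  elim: m => [|m IH] a x z /=; first by rewrite scaler0 addr0.
  have [lpsi _] := psi1 m.
  rewrite /step IH lpsi scalerDr addrACA; congr (_ + _).
  by rewrite scalerDr !scalerA [_ * a]mulrC.
have phid m n x : (m <= n)%N -> rnorm (phi n x - phi m x) <= 3 / 2 * (w m - w n) * rnorm x.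
  elim: n => [|n IH].
    by rewrite leqn0 => /eqP ->; rewrite !subrr mulr0 mul0r rnorm0.
  rewrite leq_eqVlt => /predU1P[->|mn]; first by rewrite !subrr mulr0 mul0r rnorm0.
  rewrite /= /step addrAC; apply: le_trans (rnormD _ _) _.
  rewrite rnorm_of_realZ sgnE.
  have := IH mn; have [_ /(_ x)] := psi1 n; rewrite mul1r => p1 p2.
  have := ler_wpM2l (ltW (w0 n)) p1; rewrite wS => p3.
  apply: le_trans (lerD p2 p3) _; lra.
have w_lim (c e : R) : 0 < e -> exists m, c * w m <= e.
  move=> e0; exists (Num.truncn (c / e)).+1; set m := _.+1.
  have cm : c / e < m%:R by rewrite /m truncnS_gt.
  rewrite /w exprVn ler_pdivrMr ?exprn_gt0// mulrC -ler_pdivrMr//.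
  apply: le_trans (ltW cm) _; rewrite -natrX ler_nat; exact/ltnW/ltn_expl.
have /choice[f fP] x : exists l : K^o, forall e : R, 0 < e -> exists m0, forall m,
    (m0 <= m)%N -> rnorm (l - phi m x) <= e.
  apply: scalars_cauchy_cvg => e e0.
  have [m0 m0e] := w_lim (3 / 2 * rnorm x) _ e0; exists m0 => m /phid mm0.
  apply: le_trans (mm0 x) (le_trans _ m0e).
  by rewrite mulrAC ler_wpM2l ?mulr_ge0 ?rnorm_ge0// gerBl ltW.
have fphi m x : rnorm (f x - phi m x) <= 3 / 2 * w m * rnorm x.
  apply/ler_addgt0Pr => e e0; have [m0 fm] := fP x _ e0.
  rewrite -(subrKA (phi (maxn m m0) x)); apply: le_trans (rnormD _ _) _.
  rewrite addrC lerD ?fm ?leq_maxr//; apply: le_trans (phid _ _ _ (leq_maxl m m0)) _.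
  by rewrite ler_wpM2r ?rnorm_ge0// ler_wpM2l// gerBl ltW.
have lf : linear (f : E -> K^o).
  move=> a x z; apply/eqP; rewrite -subr_eq0; apply/eqP/rnorm_eq0/le_anti.
  rewrite rnorm_ge0 andbT; apply/ler_addgt0Pr => e e0; rewrite add0r.
  have [m me] := w_lim (3 / 2 * rnorm (a *: x + z) +
     (realpart `|a| * (3 / 2 * rnorm x) + 3 / 2 * rnorm z)) _ e0.
  have -> : f (a *: x + z) - (a *: f x + f z) = (f (a *: x + z) - phi m (a *: x + z))
     + ((- a) *: (f x - phi m x) - (f z - phi m z)).
    by rewrite phil scaleNr scalerBr -opprD addrACA -opprD opprB subrKA.
  apply: le_trans (rnormD _ _) _; apply: le_trans (lerD (fphi _ _) (rnormD _ _)) _.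
  rewrite rnormZ normrN rnormN; apply: le_trans me; rewrite !mulrDl.
  have a0 : 0 <= realpart `|a|.
    by rewrite -(ler_of_real k) of_real0 realpart_ge0K.
  have := ler_wpM2l a0 (fphi m x); have := fphi m z.
  lra.
have [g gf] := linear_bundle lf.
have fb : bounded_by (3 / 2) (f : E -> K^o).
  split=> // x; apply: le_trans (_ : rnorm (f x - phi 0 x) <= _).
    by rewrite /= subr0.
  by apply: le_trans (fphi 0 x) _; rewrite /w expr0 mulr1.
have := yw g; rewrite gf => /(_ (bounded_by_continuous fb)).
rewrite /seq_l /= /power_sum => /(nneseries_ltyP (fun j => powR_ge0 _ _))[B fB].
have qB m : 2 ^+ m <= 4 * B `^ t^-1.
  have [_ q6 qm] := NpsiP m; rewrite -/(nn m) -/(psi m) in q6 qm.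
  have fq : q (nn m) f <= B `^ t^-1.
    rewrite trunc_norm.unlock ge0_ler_powR ?nnegrE ?invr_ge0 ?(ltW t0) ?fB//.
      by apply: sumr_ge0 => j _; exact: powR_ge0.
    apply: le_trans (fB 0%N); first by rewrite big_geq.
  have w2 : 0 < 2 / w m by rewrite divr_gt0.
  (* The tail, rescaled into the unit ball, is compared with the nearly norming
     [psi m]. *)
  have dm : bounded_by 1 (fun x => of_real k (2 / w m) *: (f x + of_real k (- 1) *: phi m.+1 x) : K^o).
    split=> [a x z|x].
      rewrite phil lf !scalerDr !scalerA addrACA -!mulrA ![a * _]mulrC.
      by rewrite !mulrA.
    rewrite rnorm_of_realZ gtr0_norm// -ler_pdivlMl// mul1r.
    rewrite of_realN of_real1 scaleN1r; apply: le_trans (fphi m.+1 x) _.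
    by rewrite wS invf_div ler_wpM2r ?rnorm_ge0//; lra.
  have := qm _ dm; rewrite (trunc_normZ t1) gtr0_norm// -ler_pdivlMl// invf_div => qd.
  have := trunc_normD t1 (nn m) (fun j => of_real k (- 1) *: (f (y j) + of_real k (- 1) *: phi m.+1 (y j)))
    (fun j => f (y j)).
  rewrite (trunc_normZ t1) normrN1 mul1r.
  rewrite (_ : _ \+ _ = fun j => phi m.+1 (y j)); last first.
    apply/funext => j /=; rewrite of_realN of_real1 !scaleN1r opprB.
    by rewrite addrNK.
  have := stepq m (phi m); rewrite -/(phi m.+1) => q1 q2.
  have q3 : w m * q (nn m) (psi m) <= 4 * B `^ t^-1.
    move: (le_trans q1 q2) qd fq; lra.
  apply: le_trans q3; apply: le_trans (ler_wpM2l (ltW (w0 m)) q6).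
  by rewrite /w -exprMn (_ : 3^-1 * 6 = 2)//; lra.
pose M := 4 * B `^ t^-1.
have := qB (Num.truncn M).+1; apply/negP; rewrite -ltNge.
have : M < (Num.truncn M).+1%:R by rewrite truncnS_gt.
move/lt_le_trans; apply; rewrite -natrX ler_nat; exact/ltnW/ltn_expl.
Qed.

End UniformBoundedness.

Lemma nneseries_pairing (R : realType) : exists e : nat -> nat * nat,
  forall F : nat -> nat -> \bar R, (forall m i, 0 <= F m i)%E ->
  (\sum_(0 <= l <oo) F (e l).1 (e l).2 =
   \sum_(0 <= m <oo) \sum_(0 <= i <oo) F m i)%E.
Proof.
have /card_set_bijP[e eb] : ([set: nat] #= [set: nat * nat])%card.
  by rewrite card_eq_sym; exact: card_nat2.
exists e => F F0.
rewrite nneseries_esumT//; transitivity (\esum_(x in [set: nat * nat]) F x.1 x.2)%E.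
  by rewrite (reindex_esum setT setT e (fun x => F x.1 x.2)).
rewrite -setXTT -[X in esum X _]/([set: nat] `*`` (fun=> [set: nat])).
rewrite -esum_esum// nneseries_esumT; last first.
  by move=> m; apply: nneseries_ge0.
by apply: eq_esum => m _; rewrite nneseries_esumT.
Qed.

Section WeaklySummable.
Variables (R : realType) (k : scalar_kind) (t : R).
Hypothesis t0 : 0 < t.
Local Notation K := (scalars R k).
Variable E : normedModType K.
Variables (y : nat -> E) (B : R).
Hypothesis yB : forall f : E -> K^o, bounded_by 1 f ->
  forall N, \sum_(0 <= j < N) rnorm (f (y j)) `^ t <= B.

Lemma bounded_by_sum_le c (f : E -> K^o) : 0 <= c -> bounded_by c f ->
  forall N, \sum_(0 <= j < N) rnorm (f (y j)) `^ t <= c `^ t * B.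
Proof.
move=> c0 fc N; have [c_eq0|cn0] := eqVneq c 0.
  have f0 x : rnorm (f x) = 0.
    have [_ /(_ x)] := fc; rewrite c_eq0 mul0r => fx.
    by apply/le_anti; rewrite fx rnorm_ge0.
  by rewrite big1 ?c_eq0 ?powR0 ?gt_eqF ?mul0r// => j _; rewrite f0 powR0 ?gt_eqF.
have cp : 0 < c by rewrite lt0r cn0.
have := bounded_byZ c^-1 fc; rewrite ger0_norm ?invr_ge0// mulVf// => /yB/(_ N) fB.
rewrite mulrC -ler_pdivrMr ?powR_gt0//; apply: le_trans fB.
rewrite mulr_suml ler_sum// => j _.
rewrite rnorm_of_realZ powRM ?rnorm_ge0// ger0_norm ?invr_ge0// mulrC.
by rewrite -[c^-1]powR_inv1// -powRrM mulN1r powRN.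
Qed.

Lemma seq_lw_of_bounded : seq_lw t E y.
Proof.
move=> phi /continuous_bounded_by[c c0 phic].
rewrite /seq_l /= /power_sum; apply/nneseries_ltyP => [j|]; first exact: powR_ge0.
by exists (c `^ t * B) => N; exact: bounded_by_sum_le.
Qed.

End WeaklySummable.

(** * Mixtures of functionals *)

Section Mixtures.
Variables (R : realType) (k : scalar_kind) (p : R).
Hypothesis p1 : 1 <= p.
Local Notation K := (scalars R k).
Variable E : normedModType K.
Implicit Types (psi : nat -> E -> K^o) (x : E).

Let p0 : 0 < p. Proof. exact: lt_le_trans p1. Qed.

(** Equivalently [psi i] is [c i `^ p^-1] times a functional of norm at most 1,
    where the [c i] are the masses of a discrete subprobability on the dual
    ball; [mass] is then the integral of the p-th power of [|f x|]. *)
Definition mixture psi : Prop := exists2 g : nat -> R,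
  forall i, 0 <= g i /\ bounded_by (g i) (psi i) &
  (\sum_(0 <= i <oo) (g i `^ p)%:E <= 1)%E.

Definition mass psi x : R := fine (power_sum p (fun i => psi i x)).

Lemma mixture_power_sum_le psi x : mixture psi ->
  (power_sum p (fun i => psi i x) <= (rnorm x `^ p)%:E)%E.
Proof.
move=> [g gpsi g1].
apply: (@le_trans _ _ (\sum_(0 <= i <oo) (rnorm x `^ p)%:E * (g i `^ p)%:E)%E).
  apply: lee_nneseries => i _; first by rewrite lee_fin powR_ge0.
  have [g0 [_ gx]] := gpsi i.
  rewrite -EFinM lee_fin -powRM ?rnorm_ge0// mulrC.
  by rewrite ge0_ler_powR ?nnegrE ?mulr_ge0 ?rnorm_ge0 ?(ltW p0).
rewrite nneseriesZl; last by move=> i _; rewrite lee_fin powR_ge0.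
by rewrite -[leRHS]mule1 lee_wpmul2l// lee_fin powR_ge0.
Qed.

Lemma massE psi x : mixture psi ->
  (mass psi x)%:E = power_sum p (fun i => psi i x).
Proof.
move=> /(mixture_power_sum_le x) psix; rewrite fineK// ge0_fin_numE ?power_sum_ge0//.
exact: le_lt_trans psix (ltry _).
Qed.

Lemma mass_ge0 psi x : 0 <= mass psi x.
Proof. by rewrite fine_ge0// power_sum_ge0. Qed.

Lemma mass_le psi x : mixture psi -> mass psi x <= rnorm x `^ p.
Proof. by move=> mpsi; rewrite -lee_fin massE// mixture_power_sum_le. Qed.

Lemma massZ psi (c : R) x : mixture psi -> 0 <= c ->
  mass psi (of_real k c *: x) = c `^ p * mass psi x.
Proof.
move=> mpsi c0; apply: EFin_inj; rewrite EFinM !massE// -nneseriesZl; last first.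
  by move=> i _; rewrite lee_fin powR_ge0.
have [g gpsi _] := mpsi.
apply: eq_eseriesr => i _; rewrite -EFinM; congr EFin.
have [_ [li _]] := gpsi i.
by rewrite linearPZ// rnorm_of_realZ ger0_norm// powRM ?rnorm_ge0.
Qed.

(** A countable convex combination of measures: the family of families is
    enumerated along a bijection of [nat] with [nat * nat]. *)
Lemma mixture_countable (w : nat -> R) (psi_ : nat -> nat -> E -> K^o) :
    (forall m, 0 <= w m) -> (\sum_(0 <= m <oo) (w m)%:E <= 1)%E ->
    (forall m, mixture (psi_ m)) ->
  exists2 psi, mixture psi &
    forall x, (mass psi x)%:E = (\sum_(0 <= m <oo) (w m * mass (psi_ m) x)%:E)%E.
Proof.
move=> w0 w1 mpsi; have [e eE] := nneseries_pairing R.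
have /choice[g gP] m : exists g : nat -> R,
  (forall i, 0 <= g i /\ bounded_by (g i) (psi_ m i)) /\
  (\sum_(0 <= i <oo) (g i `^ p)%:E <= 1)%E by have [g] := mpsi m; exists g.
pose psi l := fun x => of_real k (w (e l).1 `^ p^-1) *: psi_ (e l).1 (e l).2 x.
have wK m : (w m `^ p^-1) `^ p = w m.
  by rewrite -powRrM mulVf ?gt_eqF// powRr1.
have psim : mixture psi.
  exists (fun l => w (e l).1 `^ p^-1 * g (e l).1 (e l).2).
    move=> l; have [g0 gb] := (gP (e l).1).1 (e l).2.
    split; first by rewrite mulr_ge0 ?powR_ge0.
    by have := bounded_byZ (w (e l).1 `^ p^-1) gb; rewrite ger0_norm ?powR_ge0.
  rewrite (eE (fun m i => ((w m `^ p^-1 * g m i) `^ p)%:E)); last first.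
    by move=> m i; rewrite lee_fin powR_ge0.
  apply: le_trans w1; apply: lee_nneseries => m _.
    by move=> _; apply: nneseries_ge0 => i _ _; rewrite lee_fin powR_ge0.
  under eq_eseriesr => i _.
    rewrite powRM ?powR_ge0 ?((gP m).1 i).1// wK EFinM; over.
  rewrite nneseriesZl; last by move=> i _; rewrite lee_fin powR_ge0.
  by rewrite -[leRHS]mule1 lee_wpmul2l ?lee_fin//; exact: (gP m).2.
exists psi => // x; rewrite massE// /power_sum /psi.
rewrite (eE (fun m i => (rnorm (of_real k (w m `^ p^-1) *: psi_ m i x) `^ p)%:E)); last first.
  by move=> m i; rewrite lee_fin powR_ge0.
apply: eq_eseriesr => m _.
rewrite EFinM massE// -nneseriesZl; last by move=> i _; rewrite lee_fin powR_ge0.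
apply: eq_eseriesr => i _; rewrite rnorm_of_realZ ger0_norm ?powR_ge0//.
by rewrite powRM ?powR_ge0 ?rnorm_ge0// wK EFinM.
Qed.

Lemma mixture_single (f : E -> K^o) : bounded_by 1 f ->
  exists2 psi, mixture psi & forall x, mass psi x = rnorm (f x) `^ p.
Proof.
move=> f1; pose psi (i : nat) : E -> K^o := if i == 0%N then f else fun=> 0.
have psiE x : (fun i => psi i x) = fun i => if i == 0%N then f x else 0.
  by apply/funext => -[].
exists psi; last by move=> x; rewrite /mass psiE (power_sum_single p1).
exists (fun i => if i == 0%N then 1 else 0).
  move=> [|i] /=; split=> //.
  exact: (@bounded_by0 R k E K^o 0).
have -> : (\sum_(0 <= i <oo) (((if i == 0%N then 1 else 0) : R) `^ p)%R%:E =
  power_sum p (fun i => if i == 0%N then 1%R : K^o else 0%R))%E.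
  apply: eq_eseriesr => -[|i] _ /=; last by rewrite rnorm0.
  by rewrite /rnorm normr1 -(of_real1 R k) of_realK.
by rewrite (power_sum_single p1) /rnorm normr1 -(of_real1 R k) of_realK powR1.
Qed.

Lemma mixture_convex (c : R) psi psi' : 0 <= c <= 1 -> mixture psi -> mixture psi' ->
  exists2 psi'', mixture psi'' &
    forall x, mass psi'' x = (1 - c) * mass psi x + c * mass psi' x.
Proof.
move=> /andP[c0 c1] mpsi mpsi'.
pose w m : R := if m is m'.+1 then if m' is 0%N then c else 0 else 1 - c.
pose psi_ m := if m is 0%N then psi else psi'.
have two (f : nat -> R) : (forall m, f m.+2 = 0) ->
    (\sum_(0 <= m <oo) (f m)%:E = (f 0%N + f 1%N)%:E)%E.
  move=> f0; apply: (@lim_near_cst _ _ _ _ _ _ _) => //.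
  exists 2%N => // -[|[|m]] //= _.
  rewrite sumEFin !big_nat_recl// big1_seq ?addr0// => i _; exact: f0.
have [m|||psi'' m'' E''] := @mixture_countable w psi_.
- by case: m => [|[|m]] //=; rewrite subr_ge0.
- by rewrite two//= subrK.
- by case.
exists psi'' => // x; apply: EFin_inj; rewrite E'' two// => m /=.
by rewrite mul0r.
Qed.

(** A mixture is p-summing as an operator into [l_p], because the p-summing
    norm of each functional is its norm. *)
Lemma mixture_summable psi (y : nat -> E) : mixture psi -> seq_lw p E y ->
  (\sum_(0 <= j <oo) (mass psi (y j))%:E < +oo)%E.
Proof.
move=> mpsi /(seq_lw_bounded p1)[B B1 yB]; have [g gpsi g1] := mpsi.
apply: (@le_lt_trans _ _ B%:E); last exact: ltry.
under eq_eseriesr do rewrite massE//.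
rewrite /power_sum nneseries_interchange; last by move=> *; rewrite lee_fin powR_ge0.
apply: (@le_trans _ _ (\sum_(0 <= i <oo) B%:E * (g i `^ p)%:E)%E).
  apply: lee_nneseries => i _.
    by move=> _; apply: nneseries_ge0 => j _ _; rewrite lee_fin powR_ge0.
  have [g0 gb] := gpsi i; rewrite -EFinM mulrC; apply: lime_le.
    by apply: is_cvg_nneseries => j _ _; rewrite lee_fin powR_ge0.
  apply: nearW => N; rewrite sumEFin lee_fin.
  exact: (bounded_by_sum_le p0 yB).
rewrite nneseriesZl; last by move=> i _; rewrite lee_fin powR_ge0.
by rewrite -[leRHS]mule1 lee_wpmul2l// lee_fin (le_trans ler01).
Qed.

End Mixtures.

(** * From n-linear coincidence to the r-summability of mixtures *)

Lemma prod_root_le_sum (R : realType) (n : nat) (a : 'I_n -> R) : (0 < n)%N ->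
  (forall i, 0 <= a i) -> (\prod_i a i) `^ n%:R^-1 <= \sum_i a i.
Proof.
move=> n0 a0; set M := \sum_i a i.
have M0 : 0 <= M by exact: sumr_ge0.
have nn0 : n%:R != 0 :> R by rewrite pnatr_eq0 -lt0n.
have -> : M = (M ^+ n) `^ n%:R^-1 by rewrite -powR_mulrn// -powRrM mulfV// powRr1.
rewrite ge0_ler_powR ?nnegrE ?invr_ge0 ?exprn_ge0 ?prodr_ge0//.
rewrite -[X in M ^+ X]card_ord -prodr_const ler_prod// => i _.
by rewrite a0 /M (bigD1 i)//= lerDl sumr_ge0.
Qed.

Lemma powR_prod (R : realType) (I : finType) (a : I -> R) (q : R) :
  (forall i, 0 <= a i) -> (\prod_i a i) `^ q = \prod_i a i `^ q.
Proof.
move=> a0; pose P (x y : R) := 0 <= x /\ x `^ q = y.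
suff [] : P (\prod_i a i) (\prod_i a i `^ q) by [].
apply: (big_ind2 P) => [|x _ y _ [x0 <-] [y0 <-]|i _]; split=> //.
- by rewrite powR1.
- exact: mulr_ge0.
- exact: powRM.
Qed.

Lemma summable_prod_root (R : realType) (n : nat) (f : 'I_n -> nat -> R) :
    (0 < n)%N -> (forall i j, 0 <= f i j) ->
    (forall i, (\sum_(0 <= j <oo) (f i j)%:E < +oo)%E) ->
  (\sum_(0 <= j <oo) ((\prod_i f i j) `^ n%:R^-1)%:E < +oo)%E.
Proof.
move=> n0 f0 fs.
have /choice[B fB] i : exists B, forall N, \sum_(0 <= j < N) f i j <= B.
  exact/nneseries_ltyP.
apply/nneseries_ltyP => [j|]; first exact: powR_ge0.
exists (\sum_i B i) => N.
apply: (@le_trans _ _ (\sum_(0 <= j < N) \sum_i f i j)).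
  by apply: ler_sum => j _; exact: prod_root_le_sum.
by rewrite exchange_big /= ler_sum.
Qed.

Section ScalarProducts.
Variables (R : realType) (k : scalar_kind).
Local Notation K := (scalars R k).

Lemma rnorm1 : rnorm (1 : K^o) = 1 :> R.
Proof. by rewrite /rnorm normr1 -(of_real1 R k) of_realK. Qed.

Lemma rnorm_prod (I : finType) (P : pred I) (f : I -> K) :
  rnorm (\prod_(i | P i) f i : K^o) = \prod_(i | P i) rnorm (f i : K^o).
Proof.
apply: (big_morph (fun z : K => rnorm (z : K^o))) => [x y|]; last exact: rnorm1.
exact: rnormM.
Qed.

End ScalarProducts.

(** A linear operator seen as an n-linear one, by multiplying it with copies
    of a functional in the remaining variables. *)
Section Multilinearization.
Variables (R : realType) (k : scalar_kind) (n : nat).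
Local Notation K := (scalars R k).
Variables (E F : normedModType K) (i0 : 'I_n) (phi : E -> K^o) (u : E -> F).
Variables (c d : R).
Hypotheses (phic : bounded_by c phi) (ud : bounded_by d u).

Definition multilinearization (x : 'I_n -> E) : F :=
  (\prod_(i | i != i0) (phi (x i) : K)) *: u (x i0).

Lemma multilinearization_multilinear : multilinear multilinearization.
Proof.
have [lphi _] := phic; have [lu _] := ud.
move=> i x a v w; rewrite /multilinearization.
have [->|ii0] := eqVneq i i0.
  rewrite !dfwithin lu scalerDr scalerA [_ * a]mulrC -scalerA.
  congr (_ *: (_ *: _) + _ *: _); apply: eq_bigr => j ji0;
    by rewrite !dfwithout// eq_sym.
rewrite !dfwithout//.
rewrite (bigD1 i)//= [in X in _ *: (X *: _)](bigD1 i)//=.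
rewrite [in X in _ + X *: _](bigD1 i)//= !dfwithin lphi.
under eq_bigr => j /andP[_ ji] do rewrite dfwithout 1?eq_sym//.
under [in X in _ *: (X *: _)]eq_bigr => j /andP[_ ji] do rewrite dfwithout 1?eq_sym//.
under [in X in _ + X *: _]eq_bigr => j /andP[_ ji] do rewrite dfwithout 1?eq_sym//.
by rewrite mulrDl scalerDl scalerA mulrA.
Qed.

Lemma multilinearization_continuous :
  continuous (multilinearization : {ptws 'I_n -> E} -> F).
Proof.
move=> x.
have px i : (fun z : {ptws 'I_n -> E} => z i) @ x --> x i.
  exact: (@proj_continuous 'I_n (fun=> E) i x).
have ux : (fun z : {ptws 'I_n -> E} => u (z i0)) @ x --> u (x i0).
  exact: (cvg_comp (fun z : {ptws 'I_n -> E} => z i0) u (px i0)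
    (bounded_by_continuous ud (x := x i0))).
have fx i : (fun z : {ptws 'I_n -> E} => phi (z i)) @ x --> phi (x i).
  exact: (cvg_comp (fun z : {ptws 'I_n -> E} => z i) phi (px i)
    (bounded_by_continuous phic (x := x i))).
have prx : (fun z : {ptws 'I_n -> E} => \prod_(i | i != i0) (phi (z i) : K)) @ x
    --> (\prod_(i | i != i0) (phi (x i) : K) : K^o).
  exact: (@cvg_big K^o 'I_n _ 1 _ (@mul_continuous K) _ (nbhs x) _ (fun i z => phi (z i))
    (fun i => phi (x i)) _ (fun i _ => fx i)).
exact: (@cvgZ K F {ptws 'I_n -> E} (nbhs x) _ _ _ _ _ prx ux).
Qed.

Lemma rnorm_multilinearization x :
  rnorm (multilinearization x) =
  \prod_i (if i == i0 then rnorm (u (x i)) else rnorm (phi (x i))).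
Proof.
rewrite /multilinearization rnormZ -[realpart _]/(rnorm (_ : K^o)) rnorm_prod.
rewrite [RHS](bigD1 i0)//= eqxx mulrC; congr (_ * _).
by apply: eq_bigr => i /negbTE ->.
Qed.

End Multilinearization.

Section MixtureSummability.
Variables (R : realType) (k : scalar_kind) (n : nat) (p r : R).
Hypotheses (n1 : (1 <= n)%N) (p1 : 1 <= p) (r1 : 1 < r).
Local Notation K := (scalars R k).
Variable X : normedModType K.
Hypothesis coincidence :
  L_as n (p / n%:R) p X (lp k p1) `<=` L_as n (r / n%:R) r X (lp k p1).

Let p0 : 0 < p. Proof. exact: lt_le_trans p1. Qed.
Let r0 : 0 < r. Proof. exact: lt_trans r1. Qed.

Lemma mixture_operator (psi : nat -> X -> K^o) : mixture p psi ->
  exists2 u : X -> lp k p1, bounded_by 1 u &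
    forall x, rnorm (u x) = mass p psi x `^ p^-1.
Proof.
move=> mpsi; have P x : (fun i => psi i x) \in lp_pred p1.
  by rewrite inE /= /seq_l /= -(massE p1)// ltry.
pose u x : lp k p1 := Lp (P x).
have uE x : rnorm (u x) = mass p psi x `^ p^-1.
  by rewrite /rnorm lp_normE of_realK lp_norm.unlock.
have [g gpsi _] := mpsi.
exists u => //; split=> [a x y|x].
  by apply/val_inj/funext => i; have [_ [li _]] := gpsi i; exact: li.
rewrite mul1r uE -[leRHS](@powRr1 _ (rnorm x)) ?rnorm_ge0//.
rewrite -(@mulfV _ p) ?gt_eqF// powRrM ge0_ler_powR ?nnegrE ?invr_ge0 ?(ltW p0)//.
- exact: mass_ge0.
- exact: powR_ge0.
- exact: mass_le.
Qed.

(** The operator of the mixture is made n-linear with the help of a functional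
    [phi] with [phi e = 1], and tested on [z] in one variable and on sequences
    of multiples of [e] in the others; these multiples are the arbitrary
    factors that Landau's theorem removes. *)
Lemma mixture_r_summable (psi : nat -> X -> K^o) (z : nat -> X) :
  mixture p psi -> seq_lw r X z ->
  (\sum_(0 <= j <oo) (mass p psi (z j) `^ (r / p))%:E < +oo)%E.
Proof.
move=> mpsi zr; have [g gpsi g1] := mpsi.
(* If every functional of the mixture vanishes on [z] then all masses are 0;
   otherwise one of them serves as [phi]. *)
have [[[i j] phi_neq0]|psi0] :=
    pselect (exists ij, psi ij.1 (z ij.2) != 0); last first.
  rewrite eseries0 ?ltry// => j _ _; rewrite /mass /power_sum eseries0.
    by rewrite /= powR0// mulf_neq0 ?invr_eq0 ?gt_eqF.
  move=> i _ _; have -> : psi i (z j) = 0.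
    by apply/eqP/negP => /negP ne; apply: psi0; exists (i, j).
  by rewrite rnorm0 powR0 ?gt_eqF.
have [gi0 phib] := gpsi i; set phi := psi i in phi_neq0 phib.
pose e := (phi (z j))^-1 *: z j.
have phie : phi e = 1.
  by have [lphi _] := phib; rewrite /e linearPZ//; exact: mulVf.
have [u ub uE] := mixture_operator mpsi.
pose i0 : 'I_n := Ordinal n1.
pose T := multilinearization i0 phi u.
have rT x := rnorm_multilinearization i0 phi u x.
have nn0 : 0 < n%:R :> R by rewrite ltr0n.
have TE q x : rnorm (T x) `^ (q / n%:R) =
    (\prod_i (if i == i0 then rnorm (u (x i)) else rnorm (phi (x i))) `^ q) `^ n%:R^-1.
  rewrite powRrM rT powR_prod// => i'; case: ifP => _; exact: rnorm_ge0.
have : L_as n (p / n%:R) p X (lp k p1) T.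
  split; [exact: multilinearization_multilinear phib ub|
          exact: multilinearization_continuous phib ub|].
  move=> x xp; rewrite /seq_l /= /power_sum; under eq_eseriesr do rewrite TE.
  apply: (summable_prod_root (f := fun i j => (if i == i0 then rnorm (u (x i j))
     else rnorm (phi (x i j))) `^ p)) => // [i' j'|i']; first exact: powR_ge0.
  case: (i' == i0).
    under eq_eseriesr do rewrite uE -powRrM mulVf ?gt_eqF// powRr1 ?mass_ge0//.
    exact: (mixture_summable p1).
  have [f ff] := linear_bundle phib.1.
  have := xp i' f; rewrite ff => /(_ (bounded_by_continuous phib)); exact.
move=> /coincidence[_ _ rsum].
apply: (@summable_of_geo_means _ n%:R^-1).
- by rewrite invr_gt0 nn0 invf_le1// ler1n.
- by move=> l; exact: powR_ge0.
move=> s s0 ssum.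
pose x i l := if i == i0 then z l else of_real k (s l `^ r^-1) *: e.
have sK l : (s l `^ r^-1) `^ r = s l.
  by rewrite -powRrM mulVf ?gt_eqF// powRr1.
have xr i' : seq_lw r X (x i').
  rewrite /x; case: (i' == i0) => // f _; rewrite /seq_l /= /power_sum.
  under eq_eseriesr => l _.
    rewrite linearZ rnorm_of_realZ ger0_norm ?powR_ge0//.
    rewrite powRM ?powR_ge0 ?rnorm_ge0// sK mulrC EFinM; over.
  rewrite /= nneseriesZl ?lte_mul_pinfty ?lee_fin ?powR_ge0//.
  by move=> l _; rewrite lee_fin.
have := rsum x xr; rewrite /seq_l /= /power_sum.
rewrite (_ : (\sum_(0 <= l <oo) _)%E = (\sum_(0 <= l <oo)
  (s l `^ (1 - n%:R^-1) * (mass p psi (z l) `^ (r / p)) `^ n%:R^-1)%:E)%E)//.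
apply: eq_eseriesr => l _; congr EFin; rewrite TE (bigD1 i0)//= /x eqxx uE.
under eq_bigr => i' /negbTE ii0.
  rewrite ii0 (linearPZ phib.1) rnorm_of_realZ phie rnorm1 mulr1.
  rewrite ger0_norm ?powR_ge0// sK; over.
rewrite prodr_const cardC1 card_ord powRM ?exprn_ge0 ?powR_ge0// mulrC.
rewrite -(powRrM _ p^-1 r) [p^-1 * r]mulrC; congr (_ * _).
rewrite -powR_mulrn// -powRrM; congr (_ `^ _).
by rewrite -subn1 natrB// mulrBl mul1r divff// gt_eqF.
Qed.

End MixtureSummability.

(** * The extrapolation constant *)

Section ExtrapolationConstant.
Variables (R : realType) (k : scalar_kind) (p r : R).
Hypotheses (p1 : 1 <= p) (r0 : 0 < r) (rp : r <= p).
Local Notation K := (scalars R k).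
Variable X : normedModType K.
Hypothesis r_summing : forall (psi : nat -> X -> K^o) (z : nat -> X),
  mixture p psi -> seq_lw r X z ->
  (\sum_(0 <= j <oo) (mass p psi (z j) `^ (r / p))%:E < +oo)%E.

Let p0 : 0 < p. Proof. exact: lt_le_trans p1. Qed.

(** Both mixtures and weights can be mixed countably many times, which turns
    the r-summability of every mixture into an estimate with one constant.
    The bound [c] makes the mixed weights finite where all functionals vanish
    at [x j]. *)
Lemma mixture_r_summing_constant (x : nat -> X) (c : nat -> R) :
  exists2 C, 0 <= C & forall psi : nat -> X -> K^o, mixture p psi ->
    forall v : nat -> R, (forall j, 0 <= v j <= c j) ->
    (forall f : X -> K^o, bounded_by 1 f ->
       forall N, \sum_(0 <= j < N) v j * rnorm (f (x j)) `^ r <= 1) ->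
    forall N, \sum_(0 <= j < N) v j * mass p psi (x j) `^ (r / p) <= C.
Proof.
pose P := [set a : (nat -> X -> K^o) * (nat -> R) |
  [/\ mixture p a.1, forall j, 0 <= a.2 j <= c j &
   forall f : X -> K^o, bounded_by 1 f ->
       forall N, \sum_(0 <= j < N) a.2 j * rnorm (f (x j)) `^ r <= 1]].
pose G (a : (nat -> X -> K^o) * (nat -> R)) :=
  (\sum_(0 <= j <oo) (a.2 j * mass p a.1 (x j) `^ (r / p))%:E)%E.
have term0 a j : P a -> 0 <= a.2 j * mass p a.1 (x j) `^ (r / p).
  by move=> [_ /(_ j)/andP[aj _] _]; rewrite mulr_ge0 ?powR_ge0.
have h0 m : 0 <= (2^-1 : R) ^+ m by rewrite exprn_ge0.
have [||C C0 GC] := @bounded_of_mixture R _ P G.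
- move=> a aP.
  have am m : mixture p (a m).1 by have [] := aP m.
  have [psi mpsi psiE] := mixture_countable p1 (fun m => h0 m.+1)
    (@nneseries_half_pow R) am.
  have a2 m j : 0 <= (a m).2 j <= c j by have [_ /(_ j)] := aP m.
  have a0 m j : 0 <= (a m).2 j by have /andP[] := a2 m j.
  have [v [vc av vE]] := dyadic_mixture a2.
  have v0 j : 0 <= v j by have /andP[] := vc j.
  have mass_m m j : mass p (a m).1 (x j) <= 2 ^+ m.+1 * mass p psi (x j).
    rewrite -ler_pdivrMl ?exprn_gt0// -exprVn -lee_fin psiE.
    rewrite (@nneseriesD1 _ _ m)//=; last first.
      by move=> i _; rewrite lee_fin mulr_ge0 ?mass_ge0.
    by rewrite leeDl// nneseries_ge0// => i _ _; rewrite lee_fin mulr_ge0 ?mass_ge0.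
  exists (psi, v).
    split=> //= f f1 N; rewrite -lee_fin -sumEFin.
    rewrite (eq_bigr (fun j => \sum_(0 <= m <oo)
        (2^-1 ^+ m.+1 * ((a m).2 j * rnorm (f (x j)) `^ r))%:E)%E); last first.
      move=> j _; rewrite mulrC EFinM vE -nneseriesZl; last first.
        by move=> m _; rewrite lee_fin mulr_ge0.
      by apply: eq_eseriesr => m _; rewrite -EFinM mulrC mulrA.
    rewrite -nneseries_sum_nat; last first.
      by move=> *; rewrite lee_fin !mulr_ge0 ?powR_ge0.
    apply: le_trans (@nneseries_half_pow R); apply: lee_nneseries => m _.
      by move=> _; rewrite sumEFin lee_fin sumr_ge0// => j _; rewrite !mulr_ge0 ?powR_ge0.
    rewrite sumEFin lee_fin -mulr_sumr ler_piMr//.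
    by have [_ _ /(_ f f1 N)] := aP m.
  move=> m; rewrite /G -nneseriesZl; last first.
    by move=> j _; rewrite lee_fin mulr_ge0 ?powR_ge0.
  apply: lee_nneseries => j _; first by rewrite lee_fin term0.
  rewrite -EFinM lee_fin /=.
  have -> : (4 : R) ^+ m.+1 = 2 ^+ m.+1 * 2 ^+ m.+1.
    by rewrite -exprMn; congr (_ ^+ _); ring.
  rewrite mulrACA ler_pM ?powR_ge0//.
  apply: (@le_trans _ _ ((2 ^+ m.+1 * mass p psi (x j)) `^ (r / p))).
    by rewrite ge0_ler_powR ?nnegrE ?divr_ge0 ?mulr_ge0 ?mass_ge0 ?exprn_ge0 ?(ltW r0) ?(ltW p0).
  rewrite powRM ?exprn_ge0 ?mass_ge0// ler_wpM2r ?powR_ge0//.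
  rewrite ler1_powR//; first by rewrite exprn_ege1// ler1n.
  by rewrite ler_pdivrMr// mul1r.
- move=> a aP; have [mpsi vc vf] := aP; rewrite /G.
  have v0 j : 0 <= a.2 j by have /andP[] := vc j.
  have vK j : (a.2 j `^ r^-1) `^ r = a.2 j.
    by rewrite -powRrM mulVf ?gt_eqF// powRr1.
  pose z j := of_real k (a.2 j `^ r^-1) *: x j.
  have zr : seq_lw r X z.
    apply: (@seq_lw_of_bounded _ _ r r0 _ _ 1) => f f1 N.
    rewrite (eq_bigr (fun j => a.2 j * rnorm (f (x j)) `^ r)); first exact: vf.
    move=> j _; rewrite /z (linearPZ f1.1) rnorm_of_realZ ger0_norm ?powR_ge0//.
    by rewrite powRM ?powR_ge0 ?rnorm_ge0// vK.
  have := r_summing mpsi zr; under eq_eseriesr => j _.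
    rewrite /z massZ ?powR_ge0// powRM ?powR_ge0 ?mass_ge0//.
    rewrite -(powRrM _ p) mulrCA divff ?gt_eqF// mulr1 vK; over.
  exact.
exists C => // psi mpsi v vc vf N.
have vP : P (psi, v) by [].
rewrite -lee_fin; apply: le_trans (GC _ vP).
rewrite -sumEFin; apply: nneseries_lim_ge => j _ _; rewrite lee_fin; exact: (term0 _ _ vP).
Qed.

End ExtrapolationConstant.

(** * Weights from a nearly maximal mixture *)

Section PowerEstimates.
Variable R : realType.
Implicit Types a b c e p r s t w z : R.

Lemma powR_antitone a b s : 0 < a -> a <= b -> s <= 0 -> b `^ s <= a `^ s.
Proof.
move=> a0 ab s0; have b0 := lt_le_trans a0 ab.
rewrite -[s]opprK !(powRN _ (- s)) lef_pV2 ?posrE ?powR_gt0//.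
by rewrite ge0_ler_powR ?nnegrE ?oppr_ge0 ?(ltW a0) ?(ltW b0).
Qed.

(** First-order effect, on the concave function [A `^ p^-1], of moving the
    part [a] of [A] towards [b]. *)
Lemma powR_perturbation p e (A : R) a b : 1 < p -> 0 < e <= 2^-1 ->
  0 <= a <= A -> 0 < A -> 0 <= b -> e * b <= A ->
  (A `^ p^-1) `^ (1 - p) * b <=
  8 * A `^ p^-1 + 2 * (p / e) * ((A + e * (b - a)) `^ p^-1 - A `^ p^-1).
Proof.
move=> p1 /andP[e0 e2] /andP[a0 aA] A0 b0 ebA.
have p0 : 0 < p by exact: lt_trans p1.
pose s := p^-1; rewrite -/s.
have s0 : 0 < s by rewrite invr_gt0.
have s1 : s < 1 by rewrite invf_lt1.
set A' := A + e * (b - a).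
have eaA : e * a <= A / 2.
  by rewrite mulrC; apply: ler_pM => //; exact: ltW.
have eb0 : 0 <= e * b by rewrite mulr_ge0// ltW.
have ea0 : 0 <= e * a by rewrite mulr_ge0// ltW.
have A'l : A / 2 <= A' by rewrite /A' mulrBr; lra.
have A'u : A' <= 2 * A by rewrite /A' mulrBr; lra.
have A'0 : 0 < A' by apply: lt_le_trans A'l; rewrite divr_gt0.
have -> : (A `^ s) `^ (1 - p) = A `^ (s - 1).
  by rewrite -powRrM mulrBr mulr1 /s mulVf ?gt_eqF.
have powB (c : R) : 0 < c -> c `^ (s - 1) * c = c `^ s.
  by move=> c0; rewrite mulrC mulr_powRB1// ltW.
have tangent : A' `^ (s - 1) * (b - a) <= p / e * (A' `^ s - A `^ s).
  have s01 : 0 < s < 1 by rewrite s0.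
  have := powR_le_tangent (divr_ge0 (ltW A0) (ltW A'0)) s01.
  rewrite powRM ?invr_ge0 ?(ltW A0) ?(ltW A'0)// -[A'^-1]powR_inv1 ?(ltW A'0)//.
  rewrite -(powRrM _ (-1)) mulN1r powRN powR_inv1 ?(ltW A'0)// ler_pdivrMr ?powR_gt0// => H.
  rewrite -(ler_pM2l e0) -(ler_pM2l s0).
  rewrite [leRHS](_ : _ = A' `^ s - A `^ s); last first.
    rewrite /s; field; apply/andP; split; by rewrite gt_eqF.
  suff -> : s * (e * (A' `^ (s - 1) * (b - a))) = A' `^ s * (s * (1 - A / A')).
    move: H; lra.
  have -> : 1 - A / A' = e * (b - a) / A'.
    by rewrite -[X in X - _](@divff _ A') ?gt_eqF// -mulrBl /A'; congr (_ / _); ring.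
  rewrite -(powB A' A'0); field; by rewrite gt_eqF.
have two_s : 2^-1 <= (2 : R) `^ (s - 1).
  by rewrite -powR_inv1// ler_powR ?ler1n//; lra.
have low : A `^ (s - 1) <= 2 * A' `^ (s - 1).
  have : (2 * A) `^ (s - 1) <= A' `^ (s - 1) by apply: powR_antitone => //; lra.
  rewrite powRM ?(ltW A0)// => H.
  have := ler_wpM2r (powR_ge0 A (s - 1)) two_s; lra.
have up : A' `^ (s - 1) * a <= 4 * A `^ s.
  apply: (@le_trans _ _ (A' `^ (s - 1) * (2 * A'))).
    by rewrite ler_wpM2l ?powR_ge0//; lra.
  rewrite mulrCA powB//.
  have : A' `^ s <= (2 * A) `^ s.
    by rewrite ge0_ler_powR ?nnegrE ?mulr_ge0 ?(ltW s0) ?(ltW A0) ?(ltW A'0).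
  rewrite powRM ?(ltW A0)// => H.
  have : (2 : R) `^ s <= 2 by rewrite ler1_powR ?ler1n// ltW.
  move=> /(ler_wpM2r (powR_ge0 A s)); lra.
have := ler_wpM2r b0 low; move: tangent up; rewrite !mulrBr; lra.
Qed.

(** Hoelder's inequality for the exponent [r = (1 - s) + s * p], in a form that
    is summed over sequences by bounding the two quotients by 1 each. *)
Lemma powR_interpolation p r s t z w c : s = (r - 1) / (p - 1) ->
  1 < r -> r < p -> 0 < t -> 0 <= z ->
  0 < w -> 0 < c ->
  t `^ (1 - r) * z `^ r <=
    w `^ (1 - s) * c `^ s * (z / w + t `^ (1 - p) * z `^ p / c).
Proof.
move=> sE r1 rp t0 z0 w0 c0.
have p1 : 0 < p - 1 by rewrite subr_gt0; exact: lt_trans rp.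
have s0 : 0 < s by rewrite sE divr_gt0// subr_gt0.
have s1 : s < 1 by rewrite sE ltr_pdivrMr// mul1r; lra.
have h0 : 0 <= t `^ (1 - p) * z `^ p by rewrite mulr_ge0 ?powR_ge0.
have := @geo_mean_le_add R (z / w) (t `^ (1 - p) * z `^ p / c) s.
rewrite !divr_ge0 ?(ltW w0) ?(ltW c0)// (ltW s0) (ltW s1) => /(_ isT isT isT).
have wc0 : 0 <= w `^ (1 - s) * c `^ s by rewrite mulr_ge0 ?powR_ge0.
move=> /(ler_wpM2l wc0); apply: le_trans.
have VE (a q : R) : 0 < a -> (a^-1) `^ q = (a `^ q)^-1.
  by move=> a0; rewrite -[a^-1]powR_inv1 ?(ltW a0)// -powRrM mulN1r powRN.
rewrite !powRM ?powR_ge0 ?invr_ge0 ?(ltW w0) ?(ltW c0) ?mulr_ge0 ?powR_ge0//.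
rewrite !VE//.
have -> : t `^ (1 - r) = (t `^ (1 - p)) `^ s.
  by rewrite -powRrM; congr (_ `^ _); rewrite sE; field; rewrite gt_eqF.
have -> : z `^ r = z `^ (1 - s) * (z `^ p) `^ s.
  rewrite -powRrM -powRD; last first.
    apply/implyP => /eqP H; suff : r = 0 by lra.
    by rewrite -H sE; field; rewrite gt_eqF.
  by congr (_ `^ _); rewrite sE; field; rewrite gt_eqF.
have wn : w `^ (1 - s) != 0 by rewrite gt_eqF ?powR_gt0.
have cn : c `^ s != 0 by rewrite gt_eqF ?powR_gt0.
move: (w `^ (1 - s)) (c `^ s) wn cn (z `^ (1 - s)) ((z `^ p) `^ s)
  ((t `^ (1 - p)) `^ s) => W C Wn Cn a b d.
suff -> : W * C * (a / W * (d * b / C)) = d * (a * b) by [].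
by field; rewrite Wn Cn.
Qed.

Lemma sum_truncated_le (f : nat -> R) M N : (forall j, 0 <= f j) ->
  \sum_(0 <= j < M) (if (j < N)%N then f j else 0) <= \sum_(0 <= j < N) f j.
Proof.
move=> f0; pose g j := if (j < N)%N then f j else 0.
have g0 j : 0 <= g j by rewrite /g; case: ifP.
apply: le_trans (sum_partial_le g0 (leq_maxl M N)) _.
rewrite (big_cat_nat (n := N)) ?leq_maxr//= [X in _ + X]big1_seq ?addr0; last first.
  by move=> j; rewrite mem_index_iota /g => /andP[_ /andP[Nj _]]; rewrite ltnNge Nj.
by rewrite big_nat [leRHS]big_nat ler_sum// => j /andP[_ jN]; rewrite /g jN.
Qed.

End PowerEstimates.

Section Weights.
Variables (R : realType) (k : scalar_kind) (p : R).
Hypothesis p1 : 1 < p.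
Local Notation K := (scalars R k).
Variables (X : normedModType K) (x : nat -> X).

Let p0 : 0 < p. Proof. exact: lt_trans p1. Qed.

Definition mixture_weight (d : nat -> R) (psi : nat -> X -> K^o) j : R :=
  (mass p psi (x j) + d j `^ p) `^ p^-1.

Lemma mixture_weight_ge d psi j : 0 <= d j -> d j <= mixture_weight d psi j.
Proof.
move=> d0; rewrite -[leLHS]powRr1// -(@mulfV _ p) ?gt_eqF// powRrM.
by rewrite ge0_ler_powR ?nnegrE ?invr_ge0 ?(ltW p0) ?addr_ge0 ?powR_ge0 ?mass_ge0//
  lerDr mass_ge0.
Qed.

(** Moving a nearly maximal mixture of functionals towards any single one
    cannot increase the sum of the weights by much, and the derivative of that
    sum is the left-hand side.  The offset [d] keeps the weights away from 0
    and makes the required step size independent of the functional. *)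
Lemma exists_near_maximal_mixture (d : nat -> R) N : (forall j, 0 < d j) ->
  exists2 psi : nat -> X -> K^o, mixture p psi &
    forall f : X -> K^o, bounded_by 1 f ->
    \sum_(0 <= j < N) mixture_weight d psi j `^ (1 - p) * rnorm (f (x j)) `^ p <=
    8 * \sum_(0 <= j < N) mixture_weight d psi j + 1.
Proof.
move=> d0; have dp j : 0 < d j `^ p by rewrite powR_gt0.
pose F psi := \sum_(0 <= j < N) mixture_weight d psi j.
pose Q := [set F psi | psi in [set psi | mixture p psi]].
have supQ : has_sup Q.
  have [psi0 mpsi0 _] := mixture_single (ltW p1) (@bounded_by0 R k X K^o 1 ler01).
  split; first by exists (F psi0); exists psi0.
  exists (\sum_(0 <= j < N) (rnorm (x j) `^ p + d j `^ p) `^ p^-1) => _ [psi mpsi <-].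
  apply: ler_sum => j _.
  rewrite ge0_ler_powR ?nnegrE ?invr_ge0 ?(ltW p0) ?addr_ge0 ?powR_ge0 ?mass_ge0//.
  by rewrite lerD2r mass_le// ltW.
(* The step [e] is small enough for [e * |f (x j)| ^ p <= d j ^ p], for all
   [j < N] and all functionals [f] of norm at most 1. *)
pose S := \sum_(0 <= j < N) rnorm (x j) `^ p / d j `^ p.
have S0 : 0 <= S by apply: sumr_ge0 => j _; rewrite divr_ge0 ?powR_ge0.
pose e := (2 + S)^-1.
have e0 : 0 < e by rewrite invr_gt0; lra.
have e2 : e <= 2^-1 by rewrite lef_pV2 ?posrE//; lra.
have eN j : (j < N)%N -> e * rnorm (x j) `^ p <= d j `^ p.
  move=> jN; rewrite /e mulrC ler_pdivrMr; last by lra.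
  rewrite mulrC -ler_pdivrMr//; apply: (@le_trans _ _ S); last by lra.
  rewrite /S big_mkord (bigD1 (Ordinal jN))//= lerDl sumr_ge0// => i _.
  by rewrite divr_ge0 ?powR_ge0.
have [|_ [psi mpsi <-] Fpsi] := sup_adherent (_ : 0 < e / (2 * p)) supQ.
  by rewrite divr_gt0// mulr_gt0.
exists psi => // f f1.
have [phi mphi phiE] := mixture_single (ltW p1) f1.
have e01 : 0 <= e <= 1 by rewrite (ltW e0)/=; lra.
have [psi' mpsi' psi'E] := mixture_convex (ltW p1) e01 mpsi mphi.
have FF : F psi' <= F psi + e / (2 * p).
  have : F psi' <= sup Q by apply: ub_le_sup; [exact: supQ.2|exists psi'].
  by move=> /le_trans; apply; rewrite -lerBlDr ltW.
have term j : (j < N)%N ->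
    mixture_weight d psi j `^ (1 - p) * rnorm (f (x j)) `^ p <=
    8 * mixture_weight d psi j +
    2 * (p / e) * (mixture_weight d psi' j - mixture_weight d psi j).
  move=> jN; rewrite /mixture_weight psi'E phiE.
  have -> : (1 - e) * mass p psi (x j) + e * rnorm (f (x j)) `^ p + d j `^ p =
    mass p psi (x j) + d j `^ p + e * (rnorm (f (x j)) `^ p - mass p psi (x j)) by ring.
  apply: powR_perturbation; rewrite ?e0 ?e2 ?mass_ge0 ?powR_ge0//.
  - by rewrite lerDl ltW.
  - by rewrite ltr_wpDl ?mass_ge0.
  apply: le_trans (ler_wpDl (mass_ge0 _ _ _) (eN j jN)).
  rewrite ler_wpM2l ?(ltW e0)// ge0_ler_powR ?nnegrE ?rnorm_ge0 ?(ltW p0)//.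
  by have [_ /(_ (x j))] := f1; rewrite mul1r.
apply: (@le_trans _ _ (8 * F psi + 2 * (p / e) * (F psi' - F psi))).
  rewrite /F -sumrB !mulr_sumr -big_split/= big_nat [leRHS]big_nat.
  by apply: ler_sum => j /andP[_ /term].
rewrite lerD2l; apply: (@le_trans _ _ (2 * (p / e) * (e / (2 * p)))).
  apply: ler_wpM2l; first by rewrite mulr_ge0// divr_ge0 ?(ltW p0) ?(ltW e0).
  by rewrite lerBlDl.
suff -> : 2 * (p / e) * (e / (2 * p)) = 1 by [].
by field; rewrite !gt_eqF.
Qed.

End Weights.

Section Extrapolation.
Variables (R : realType) (k : scalar_kind) (p r : R).
Hypotheses (r1 : 1 < r) (rp : r < p).
Local Notation K := (scalars R k).
Variable X : normedModType K.
Hypothesis r_summing : forall (psi : nat -> X -> K^o) (z : nat -> X),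
  mixture p psi -> seq_lw r X z ->
  (\sum_(0 <= j <oo) (mass p psi (z j) `^ (r / p))%:E < +oo)%E.

Let p1 : 1 < p. Proof. exact: lt_trans rp. Qed.
Let p0 : 0 < p. Proof. exact: lt_trans p1. Qed.
Let r0 : 0 < r. Proof. exact: lt_trans r1. Qed.

Section Sequence.
Variables (x : nat -> X) (w : R).
Hypothesis w1 : 1 <= w.
Hypothesis xw : forall f : X -> K^o, bounded_by 1 f ->
  forall N, \sum_(0 <= j < N) rnorm (f (x j)) <= w.

Let d j : R := 2^-1 ^+ j.+1.
Let d0 j : 0 < d j. Proof. by rewrite exprn_gt0. Qed.

(** The self-improving estimate.  With [Z] the sum of the weights [t] of a
    nearly maximal mixture, the sequence weighted by [t j `^ (1 - r)] has weak
    r-sums at most [2 * w * (8 * Z + 1) `^ s], by interpolation.  The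
    r-summing inequality for that very mixture returns [Z] itself on the other
    side, as [t j `^ (1 - r) * t j `^ r = t j]; hence [Z] is at most a
    constant times [(8 * Z + 1) `^ s], with [s < 1]. *)
Lemma finite_extrapolation_weights : exists2 B, 0 <= B & forall N,
  exists t : nat -> R, [/\ forall j, d j <= t j, \sum_(0 <= j < N) t j <= B &
    forall f : X -> K^o, bounded_by 1 f ->
      \sum_(0 <= j < N) t j `^ (1 - p) * rnorm (f (x j)) `^ p <= B].
Proof.
have [C C0 HC] := mixture_r_summing_constant (ltW p1) r0 (ltW rp) r_summing x
  (fun j => d j `^ (1 - r)).
pose s := (r - 1) / (p - 1).
have q0 : 0 < p - 1 by rewrite subr_gt0.
have s0 : 0 < s by rewrite divr_gt0// subr_gt0.
have s1 : 0 < 1 - s by rewrite subr_gt0 ltr_pdivrMr// mul1r ltrD2r.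
pose Q := 32 * C * w + 17.
have Cw0 : 0 <= C * w by rewrite mulr_ge0// (le_trans ler01).
exists (Q `^ (1 - s)^-1) => [|N]; first exact: powR_ge0.
have [psi mpsi] := exists_near_maximal_mixture p1 x N d0.
set t := mixture_weight p x d psi => tB.
have td j : d j <= t j by apply: (mixture_weight_ge p1); exact: ltW.
have t0 j : 0 < t j by exact: lt_le_trans (d0 j) (td j).
exists t; set Z := \sum_(0 <= j < N) t j in tB *.
have Z0 : 0 <= Z by apply: sumr_ge0 => j _; exact: ltW.
pose c := 8 * Z + 1; rewrite -/c in tB.
have c1 : 1 <= c by rewrite /c lerDr mulr_ge0.
have c0 : 0 < c by exact: lt_le_trans c1.
have cs1 : 1 <= c `^ s.
  by have := @ler_powR _ c c1 0 s (ltW s0); rewrite powRr0.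
have w0 : 0 < w by exact: lt_le_trans w1.
pose W := 2 * (w * c `^ s).
have wcs1 : 1 <= w * c `^ s by rewrite -[leLHS]mulr1 ler_pM.
have W1 : 1 <= W by rewrite /W; lra.
have W0 : 0 < W by exact: lt_le_trans W1.
have term0 (f : X -> K^o) j : 0 <= t j `^ (1 - r) * rnorm (f (x j)) `^ r.
  by rewrite mulr_ge0 ?powR_ge0.
have tr_le (f : X -> K^o) : bounded_by 1 f ->
    \sum_(0 <= j < N) t j `^ (1 - r) * rnorm (f (x j)) `^ r <= W.
  move=> f1.
  apply: (@le_trans _ _ (\sum_(0 <= j < N) w `^ (1 - s) * c `^ s *
     (rnorm (f (x j)) / w + t j `^ (1 - p) * rnorm (f (x j)) `^ p / c))).
    apply: ler_sum => j _; apply: powR_interpolation => //; exact: rnorm_ge0.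
  rewrite -mulr_sumr big_split/= -!mulr_suml mulrC /W ler_pM ?mulr_ge0 ?powR_ge0//.
  - rewrite addr_ge0 ?divr_ge0 ?(ltW w0) ?(ltW c0) ?sumr_ge0// => j _.
      exact: rnorm_ge0.
    by rewrite mulr_ge0 ?powR_ge0.
  - have -> : 2 = 1 + 1 :> R by ring.
    by rewrite lerD// ler_pdivrMr// mul1r ?xw ?tB.
  - rewrite ler_wpM2r ?powR_ge0// -[leRHS]powRr1 ?(ltW w0)//.
    by rewrite ler_powR// gerBl ltW.
pose v j := if (j < N)%N then t j `^ (1 - r) / W else 0.
have := HC psi mpsi v _ _ N; rewrite big_nat.
rewrite (eq_bigr (fun j => W^-1 * (t j `^ (1 - r) * mass p psi (x j) `^ (r / p)))); last first.
  by move=> j /andP[_ jN]; rewrite /v jN mulrA [W^-1 * _]mulrC.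
rewrite -big_nat -mulr_sumr mulrC => HCv.
have {HCv} Hmass : \sum_(0 <= j < N) t j `^ (1 - r) * mass p psi (x j) `^ (r / p) <= C * W.
  rewrite -ler_pdivrMr//; apply: HCv.
  - move=> j; rewrite /v; case: ifP => _; last by rewrite lexx powR_ge0.
    rewrite divr_ge0 ?powR_ge0 ?(ltW W0)//= ler_pdivrMr//.
    apply: (@le_trans _ _ (d j `^ (1 - r))).
      by apply: powR_antitone => //; rewrite subr_le0 ltW.
    by rewrite ler_peMr ?powR_ge0.
  - move=> f f1 M.
    rewrite (eq_bigr (fun j => if (j < N)%N then W^-1 *
       (t j `^ (1 - r) * rnorm (f (x j)) `^ r) else 0)); last first.
      by move=> j _; rewrite /v; case: ifP => _; rewrite ?mul0r// mulrA [W^-1 * _]mulrC.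
    apply: le_trans (sum_truncated_le _ _ _) _.
      by move=> j; rewrite mulr_ge0// invr_ge0 ltW.
    by rewrite -mulr_sumr mulrC ler_pdivrMr// mul1r tr_le.
have t_le j : t j <= 2 * (t j `^ (1 - r) * mass p psi (x j) `^ (r / p)) + 2 * d j.
  have {1}-> : t j = t j `^ (1 - r) * t j `^ r.
    by rewrite -powRD subrK ?powRr1 ?oner_eq0// ltW.
  have tE : t j `^ r = (mass p psi (x j) + d j `^ p) `^ (r / p).
    by rewrite /t /mixture_weight -powRrM mulrC.
  have rp01 : 0 <= r / p <= 1.
    by rewrite divr_ge0 ?(ltW r0) ?(ltW p0)//= ler_pdivrMr// mul1r ltW.
  have := powR_add_le (mass_ge0 p psi (x j)) (powR_ge0 (d j) p) rp01.
  rewrite -tE -(powRrM (d j)) mulrCA divff ?gt_eqF// mulr1.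
  move=> /(ler_wpM2l (powR_ge0 (t j) (1 - r)))/le_trans; apply.
  rewrite mulrCA mulrDr mulrDr lerD2l ler_wpM2l//.
  apply: (@le_trans _ _ (d j `^ (1 - r) * d j `^ r)).
    rewrite ler_wpM2r ?powR_ge0//; apply: powR_antitone => //.
    by rewrite subr_le0 ltW.
  by rewrite -powRD subrK ?powRr1 ?oner_eq0// ltW.
have Z_le : Z <= 2 * (C * W) + 2.
  apply: (@le_trans _ _ (\sum_(0 <= j < N)
    (2 * (t j `^ (1 - r) * mass p psi (x j) `^ (r / p)) + 2 * d j))).
    by apply: ler_sum.
  rewrite big_split/= -!mulr_sumr lerD ?ler_wpM2l//.
  by rewrite -[leRHS]mulr1 ler_wpM2l// sum_half_pow.
have cQ : c <= Q * c `^ s.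
  apply: (@le_trans _ _ (8 * (2 * (C * W) + 2) + 1)).
    by rewrite /c lerD2r ler_wpM2l.
  have -> : Q * c `^ s = 32 * C * w * c `^ s + 17 * c `^ s by rewrite /Q; ring.
  rewrite /W; have -> : 8 * (2 * (C * (2 * (w * c `^ s))) + 2) + 1 = 32 * C * w * c `^ s + 17 by ring.
  by rewrite lerD2l -[leLHS]mulr1 ler_wpM2l.
have Q0 : 0 < Q by rewrite /Q -mulrA; lra.
have cB : c <= Q `^ (1 - s)^-1.
  rewrite [leLHS](_ : _ = (c `^ (1 - s)) `^ (1 - s)^-1); last first.
    by rewrite -powRrM mulfV ?gt_eqF// powRr1// ltW.
  rewrite ge0_ler_powR ?nnegrE ?powR_ge0 ?invr_ge0 ?(ltW s1) ?(ltW Q0)//.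
  rewrite powRB; last by rewrite (gt_eqF c0) implybT.
  by rewrite powRr1 ?(ltW c0)// ler_pdivrMr// powR_gt0.
split=> // [|f f1]; last exact: le_trans (tB f f1) cB.
apply: le_trans cB; rewrite /c; lra.
Qed.

(** By Tychonoff's theorem the finite weights have a limit point; comparing up
    to a factor 2 avoids the continuity of the powers. *)
Lemma extrapolation_weights : exists t : nat -> R, exists B : R,
  [/\ forall j, 0 < t j, forall N, \sum_(0 <= j < N) t j <= B &
    forall f : X -> K^o, bounded_by 1 f ->
      forall N, \sum_(0 <= j < N) t j `^ (1 - p) * rnorm (f (x j)) `^ p <= B].
Proof.
have [B B0 /choice[t_ tP]] := finite_extrapolation_weights.
have d1 j : d j <= 1 by rewrite exprn_ile1// invf_le1// ler1n.
(* Beyond [N] nothing bounds the weights, and [d] replaces them. *)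
pose u N : {ptws nat -> R} := fun j => if (j < N)%N then t_ N j else d j.
pose A : set {ptws nat -> R} := [set f | forall j, `[d j, B + 1]%classic (f j)].
have cA : compact A.
  by apply: (@tychonoff nat (fun=> R) (fun j => `[d j, B + 1]%classic)) => j;
    exact: segment_compact.
have uA : (u @ \oo) A.
  exists 0%N => // N _ j /=; rewrite /u in_itv/=; have [dt tB _] := tP N.
  case: ifP => jN; last by rewrite lexx (le_trans (d1 j))// lerDr.
  rewrite dt /=; apply: (@le_trans _ _ B); last by rewrite lerDl.
  apply: le_trans tB; rewrite big_mkord (bigD1 (Ordinal jN))//= lerDl sumr_ge0//.
  by move=> i _; apply: le_trans (dt i); exact: ltW.
have [t [At clt]] := cA _ _ uA.
have td j : d j <= t j by have := At j; rewrite /= in_itv/= => /andP[].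
have t0 j : 0 < t j by exact: lt_le_trans (d0 j) (td j).
have near_t M : exists2 N, (M <= N)%N & forall j, (j < M)%N ->
    t j / 2 <= t_ N j <= 2 * t j.
  have Nt : nbhs (t : {ptws nat -> R}) [set f : {ptws nat -> R} | forall j, (j < M)%N ->
      t j / 2 <= f j <= 2 * t j].
    have near_j j : nbhs (t : {ptws nat -> R})
        [set f : {ptws nat -> R} | t j / 2 <= f j <= 2 * t j].
      have pj : (fun f : {ptws nat -> R} => f j) @ t --> t j.
        exact: (@proj_continuous nat (fun=> R) j t).
      move/cvgrPdist_lt : pj => /(_ (t j / 2)); rewrite divr_gt0// => /(_ isT).
      apply: filterS => f; rewrite /= ltr_norml => /andP[l1 l2].
      by apply/andP; split; have := t0 j; lra.
    elim: M => [|M IH]; first exact: filterS filterT.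
    apply: filterS2 IH (near_j M) => f IH fM j; rewrite ltnS leq_eqVlt => /predU1P[->//|].
    exact: IH.
  have uM : (u @ \oo) [set u N | N in [set N | (M <= N)%N]].
    by exists M => // N /= MN; exists N.
  have [f [[N MN <-] uN]] := clt _ _ uM Nt.
  exists N => // j jM; have := uN j jM; rewrite /u.
  by rewrite (leq_trans jM MN).
pose b := 2 `^ (p - 1) : R.
have b1 : 1 <= b by rewrite /b -[leLHS](powRr0 2) ler_powR ?ler1n// subr_ge0 ltW.
exists t, (2 * b * B); split=> // [M|f f1 M]; have [N MN tN] := near_t M.
  have [dt tB _] := tP N.
  apply: (@le_trans _ _ (2 * \sum_(0 <= j < M) t_ N j)).
    rewrite mulr_sumr big_nat [leRHS]big_nat; apply: ler_sum => j /andP[_ /tN/andP[]].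
    by rewrite ler_pdivrMr// mulrC.
  rewrite -mulrA ler_wpM2l//; apply: (@le_trans _ _ B); last by rewrite ler_peMl.
  by apply: le_trans (sum_partial_le _ MN) tB => j; apply: le_trans (dt j); exact: ltW.
have [dt _ /(_ f f1) tB] := tP N.
apply: (@le_trans _ _ (b * \sum_(0 <= j < M) t_ N j `^ (1 - p) * rnorm (f (x j)) `^ p)).
  rewrite mulr_sumr big_nat [leRHS]big_nat; apply: ler_sum => j /andP[_ /tN/andP[_ tNj]].
  rewrite mulrA ler_wpM2r ?powR_ge0// /b.
  have tN0 : 0 < t_ N j by exact: lt_le_trans (d0 j) (dt j).
  have tj : t_ N j / 2 <= t j by rewrite ler_pdivrMr// mulrC.
  apply: (le_trans (@powR_antitone R _ _ _ _ tj _)).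
  - by rewrite divr_gt0.
  - by rewrite subr_le0 ltW.
  rewrite powRM ?invr_ge0 ?(ltW tN0)// -[2^-1]powR_inv1// -powRrM mulN1r opprB.
  by rewrite mulrC.
apply: (@le_trans _ _ (b * B)).
  rewrite ler_wpM2l ?powR_ge0//; apply: le_trans (sum_partial_le _ MN) tB => j.
  by rewrite mulr_ge0 ?powR_ge0.
rewrite -mulrA ler_peMl ?ler1n// mulr_ge0 ?powR_ge0//.
Qed.

End Sequence.

(** Maurey's factorization: weakly summable sequences are weakly p-summable
    ones multiplied by scalars in the dual exponent. *)
Lemma seq_lw1_factorization (x : nat -> X) : seq_lw 1 X x ->
  exists t : nat -> R, exists y : nat -> X,
  [/\ forall j, 0 <= t j, (\sum_(0 <= j <oo) (t j)%:E < +oo)%E, seq_lw p X y &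
    forall j, x j = of_real k (t j `^ (1 - p^-1)) *: y j].
Proof.
move=> /(seq_lw_bounded (lexx 1))[w w1 xw].
have [|t [B [t0 tB xB]]] := @extrapolation_weights x w w1.
  move=> f f1 N; apply: le_trans (xw f f1 N).
  by apply: ler_sum => j _; rewrite powRr1 ?rnorm_ge0.
have t0' j : 0 <= t j by exact: ltW.
exists t, (fun j => of_real k (t j `^ (p^-1 - 1)) *: x j); split=> // [||j].
- by apply/nneseries_ltyP => //; exists B.
- apply: (@seq_lw_of_bounded _ _ p p0 _ _ B) => f f1 N.
  apply: le_trans (xB f f1 N); rewrite le_eqVlt; apply/orP; left; apply/eqP.
  apply: eq_bigr => j _.
  rewrite (linearPZ f1.1) rnorm_of_realZ ger0_norm ?powR_ge0//.
  rewrite powRM ?powR_ge0 ?rnorm_ge0// -powRrM mulrBl mulVf ?gt_eqF//.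
  by rewrite mul1r.
rewrite scalerA -of_realM -powRD; last by rewrite (gt_eqF (t0 j)) implybT.
by rewrite addrC subrKA subrr powRr0 of_real1 scale1r.
Qed.

End Extrapolation.

(** * Inclusions between spaces of summing mappings *)

Section Inclusions.
Variables (R : realType) (k : scalar_kind) (n : nat) (p : R).
Hypotheses (n1 : (1 <= n)%N) (p1 : 1 < p).
Local Notation K := (scalars R k).
Variables X Y : normedModType K.

Let p0 : 0 < p. Proof. exact: lt_trans p1. Qed.
Let nn0 : 0 < n%:R :> R. Proof. by rewrite ltr0n. Qed.

Lemma multilinear_scale (T : ('I_n -> X) -> Y) (c : 'I_n -> K) (x : 'I_n -> X) :
  multilinear T -> T (fun i => c i *: x i) = (\prod_i c i) *: T x.
Proof.
move=> mT; pose g (s : seq 'I_n) i := if i \in s then c i *: x i else x i.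
suff H s : uniq s -> T (g s) = (\prod_(i <- s) c i) *: T x.
  rewrite -(H _ (index_enum_uniq _)); congr T; apply/funext => i.
  by rewrite /g mem_index_enum.
elim: s => [|i s IH] /=; first by rewrite big_nil scale1r.
move=> /andP[is_ /IH Ts]; rewrite big_cons -scalerA -Ts.
have lT := mT i (g s).
have -> : g (i :: s) = @dfwith 'I_n (fun=> X) (g s) i (c i *: x i).
  apply/funext => j; case: dfwithP => [|j' ij]; first by rewrite /g inE eqxx.
  by rewrite /g inE eq_sym (negbTE ij).
rewrite (linearPZ lT); congr (_ *: T _); apply/funext => j.
by case: dfwithP => //; rewrite /g (negbTE is_).
Qed.

(** With [u] in [l_1], the multiples of [y i j] by [u j `^ (1 - p^-1)] form a
    weakly 1-summable sequence by Hoelder's inequality; Landau's theorem then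
    removes the multipliers from the norms of the values of [T]. *)
Lemma L_as_1_sub : L_as n (1 / n%:R) 1 X Y `<=` L_as n (p / n%:R) p X Y.
Proof.
move=> T [mT cT sT]; split=> // y yp; rewrite /seq_l /= /power_sum.
have s01 : 0 < p^-1 <= 1 by rewrite invr_gt0 p0 invf_le1// ltW.
apply: (summable_of_geo_means s01) => [j|u u0 us]; first exact: powR_ge0.
pose l j : R := u j `^ (1 - p^-1).
have l0 j : 0 <= l j by exact: powR_ge0.
pose x i j := of_real k (l j) *: y i j.
have x1 i : seq_lw 1 X (x i).
  move=> f fc; have := yp i f fc; rewrite /seq_l /= /power_sum => fs.
  apply: (@le_lt_trans _ _ (\sum_(0 <= j <oo) (u j)%:E +
      \sum_(0 <= j <oo) (rnorm (f (y i j)) `^ p)%:E)%E); last by rewrite lte_add_pinfty.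
  rewrite -nneseriesD; first last.
  - by move=> *; rewrite lee_fin powR_ge0.
  - by move=> *; rewrite lee_fin.
  apply: lee_nneseries => j _; first by rewrite lee_fin powR_ge0.
  rewrite -EFinD lee_fin powRr1 ?rnorm_ge0// linearZ rnorm_of_realZ ger0_norm//.
  have := @geo_mean_le_add R (u j) (rnorm (f (y i j)) `^ p) p^-1 (u0 j) (powR_ge0 _ _).
  rewrite -powRrM mulfV ?gt_eqF// powRr1 ?rnorm_ge0//; apply.
  by have /andP[/ltW -> ->] := s01.
have := sT x x1; rewrite /seq_l /= /power_sum.
rewrite (_ : (\sum_(0 <= j <oo) _)%E = (\sum_(0 <= j <oo)
  (u j `^ (1 - p^-1) * (rnorm (T (y^~ j)) `^ (p / n%:R)) `^ p^-1)%:E)%E)//.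
apply: eq_eseriesr => j _; congr EFin.
rewrite /x multilinear_scale// prodr_const card_ord.
have -> : of_real k (l j) ^+ n = of_real k (l j ^+ n).
  by elim: n => [|m IH]; rewrite ?expr0 ?of_real1// !exprS of_realM IH.
rewrite rnorm_of_realZ ger0_norm ?exprn_ge0// powRM ?exprn_ge0 ?rnorm_ge0//.
congr (_ * _).
  by rewrite -powR_mulrn// -powRrM mulrA mulr1 mulfV ?gt_eqF// powRr1.
by rewrite -powRrM; congr (_ `^ _); field; rewrite !gt_eqF.
Qed.

(** Each argument of [T] is split into a scalar and a weakly p-summable
    sequence; the scalars factor out and Hoelder's inequality applies. *)
Lemma L_as_sub_1 :
    (forall x : nat -> X, seq_lw 1 X x -> exists t : nat -> R, exists y : nat -> X,
      [/\ forall j, 0 <= t j, (\sum_(0 <= j <oo) (t j)%:E < +oo)%E, seq_lw p X y &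
        forall j, x j = of_real k (t j `^ (1 - p^-1)) *: y j]) ->
  L_as n (p / n%:R) p X Y `<=` L_as n (1 / n%:R) 1 X Y.
Proof.
move=> factor T [mT cT sT]; split=> // x x1.
have /choice[ty tyP] i : exists ty : (nat -> R) * (nat -> X),
  [/\ forall j, 0 <= ty.1 j, (\sum_(0 <= j <oo) (ty.1 j)%:E < +oo)%E, seq_lw p X ty.2 &
        forall j, x i j = of_real k (ty.1 j `^ (1 - p^-1)) *: ty.2 j].
  by have [t [y H]] := factor _ (x1 i); exists (t, y).
pose t i := (ty i).1; pose y i := (ty i).2.
have t0 i j : 0 <= t i j by have [H _ _ _] := tyP i; exact: H.
have ts i : (\sum_(0 <= j <oo) (t i j)%:E < +oo)%E by have [_ H _ _] := tyP i.
have yp i : seq_lw p X (y i) by have [_ _ H _] := tyP i.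
have := sT y yp; have := summable_prod_root n1 t0 ts.
rewrite /seq_l /= /power_sum => s1 s2.
apply: (@le_lt_trans _ _ (\sum_(0 <= j <oo) ((\prod_i t i j) `^ n%:R^-1)%:E +
   \sum_(0 <= j <oo) (rnorm (T (y^~ j)) `^ (p / n%:R))%:E)%E).
  rewrite -nneseriesD; first last.
  - by move=> *; rewrite lee_fin powR_ge0.
  - by move=> *; rewrite lee_fin powR_ge0.
  apply: lee_nneseries => j _; first by rewrite lee_fin powR_ge0.
  rewrite -EFinD lee_fin.
  have -> : (fun i => x i j) = fun i => of_real k (t i j `^ (1 - p^-1)) *: y i j.
    by apply/funext => i; have [_ _ _ H] := tyP i; exact: H.
  rewrite multilinear_scale//.
  have -> : \prod_i of_real k (t i j `^ (1 - p^-1)) =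
      of_real k ((\prod_i t i j) `^ (1 - p^-1)).
    rewrite powR_prod//; apply/esym.
    by apply: (big_morph (of_real k)) => [a b|]; [exact: of_realM|exact: of_real1].
  rewrite rnorm_of_realZ ger0_norm ?powR_ge0// powRM ?powR_ge0 ?rnorm_ge0//.
  have := @geo_mean_le_add R ((\prod_i t i j) `^ n%:R^-1)
    (rnorm (T (y^~ j)) `^ (p / n%:R)) p^-1 (powR_ge0 _ _) (powR_ge0 _ _).
  rewrite invr_ge0 (ltW p0) invf_le1// (ltW p1) => /(_ isT).
  rewrite -!powRrM; congr (_ * _ <= _); congr (_ `^ _).
    by rewrite mul1r mulrC.
  by field; rewrite !gt_eqF.
by rewrite lte_add_pinfty.
Qed.

End Inclusions.

Unset Implicit Arguments.
Set Strict Implicit.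
Set Printing Implicit Defensive.

Theorem theorem15 (R : realType) (k : scalar_kind) (n : nat) (p r : R)
    (n1 : (1 <= n)%N) (r1 : 1 < r) (rp : r < p)
    (X : completeNormedModType (scalars R k))
    (coincidence :
      L_as n (p / n%:R) p X (lp k (ltW (lt_trans r1 rp))) =
      L_as n (r / n%:R) r X (lp k (ltW (lt_trans r1 rp)))) :
  forall Y : completeNormedModType (scalars R k),
    L_as n (p / n%:R) p X Y = L_as n (1 / n%:R) 1 X Y.
Proof.
move=> Y; have p1 := lt_trans r1 rp; apply/seteqP; split; last exact: L_as_1_sub.
have sub : L_as n (p / n%:R) p X (lp k (ltW (lt_trans r1 rp))) `<=`
  L_as n (r / n%:R) r X (lp k (ltW (lt_trans r1 rp))) by rewrite coincidence.
apply: L_as_sub_1 => // x x1.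
exact: (seq_lw1_factorization r1 rp (mixture_r_summable n1 r1 sub)).
Qed.
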